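(* Let $T$ be a tree, chosen uniformly at random from the class of all labeled trees on $n$ vertices. Then asymptotically almost surely (that is, with probability tending to $1$ as $n \to \infty$), $T$ is such that Maker has a strategy to win the tree embedding game $(E(K_n), \mathcal{T}_n)$ for $T$ in $n-1$ moves (of Maker).
   Context: Maker-Breaker game: Let $X$ be a finite set (the board) and $\mathcal{F} \subseteq 2^X$ a family of winning sets. In the Maker-Breaker game $(X, \mathcal{F})$, Maker and Breaker alternately claim one previously unclaimed element of $X$ per move, with Breaker going first. Maker wins as soon as she has claimed all elements of some winning set. ''Maker has a strategy to win in $k$ moves'' means that she has a strategy that, against any strategy of Breaker, ensures that she has fully claimed a winning set after making $k$ moves of her own. Tree embedding game: For a tree $T$ on $n$ vertices, the tree embedding game $(E(K_n), \mathcal{T}_n)$ is the Maker-Breaker game whose board is the edge set of the complete graph $K_n$ and whose (minimal) winning sets are the edge sets of all labeled copies of $T$ in $K_n$; so Maker wins as soon as the graph formed by her edges contains a copy of $T$. *)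

(* Defs.v *)
From mathcomp Require Import all_boot all_order all_algebra all_fingroup.
From mathcomp Require Import all_classical all_reals all_analysis.

Set Implicit Arguments.
Unset Strict Implicit.
Unset Printing Implicit Defensive.

Import Order.TTheory GRing.Theory Num.Theory.
Import numFieldNormedType.Exports.

Section MakerBreaker.
Variable X : finType.

(* A history lists the claimed elements in the order in which they were
   claimed.  A strategy passes ([None]) exactly when the board is exhausted. *)
Definition strategy := seq X -> option X.

Definition legal (s : strategy) : Prop :=
  forall h, match s h return Prop with
            | Some x => x \notin h
            | None => forall x, x \in h
            end.

(* Breaker makes the moves of even index (so he starts), Maker the odd ones. *)
Fixpoint play (maker breaker : strategy) (t : nat) : seq X :=
  if t is t'.+1 then
    let h := play maker breaker t' in
    if (if odd t' then maker else breaker) h is Some x then rcons h x else h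
  else [::].

Definition maker_claimed (h : seq X) : {set X} :=
  [set x in h | odd (index x h)].

Definition maker_wins_in (F : {set {set X}}) (k : nat) : Prop :=
  exists2 maker, legal maker &
    forall breaker, legal breaker ->
      exists2 W, W \in F & W \subset maker_claimed (play maker breaker k.*2).

End MakerBreaker.

(* The edge set of K_n; a graph on the vertex set 'I_n is a [{set edge n}]. *)
Definition edge (n : nat) : finType := {e : {set 'I_n} | #|e| == 2}.

Section Graphs.
Variable n : nat.
Implicit Types G H T : {set edge n}.

Definition adj G : rel 'I_n :=
  fun x y => [exists e in G, val e == [set x; y]].

Definition connected_graph G : Prop := forall x y, connect (adj G) x y.

(* [ucycle] also accepts [:: x; y] when x and y are adjacent, which is not a
   cycle of a simple graph. *)
Definition acyclic_graph G : Prop :=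
  forall c : seq 'I_n, ucycle (adj G) c -> size c <= 2.

Definition is_tree G : Prop := connected_graph G /\ acyclic_graph G.

Definition labeled_trees : {set {set edge n}} := [set T | `[< is_tree T >]].

Definition copies T : {set {set edge n}} :=
  [set H | [exists s : {perm 'I_n},
             [forall x, forall y, adj H (s x) (s y) == adj T x y]]].

End Graphs.

Definition uniform_pr (R : realType) (U : finType) (A : {set U})
    (P : U -> Prop) : R :=
  (#|[set x in A | `[< P x >]]|%:R / #|A|%:R)%R.

(* Main.v *)
Require Import Defs.
From mathcomp Require Import all_boot all_order all_algebra all_fingroup.
From mathcomp Require Import all_classical all_reals all_analysis.
From mathcomp Require Import zify ring.
From mathcomp Require Import ssrnat seq path fintype finset bigop.
Import Order.TTheory GRing.Theory Num.Theory.
Import numFieldNormedType.Exports.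
Set Implicit Arguments.
Unset Strict Implicit.
Unset Printing Implicit Defensive.

(** Maker embeds the tree vertex by vertex and never wastes an edge.  Root the tree
at a vertex and call a pendant path a path of twelve vertices that starts at a
leaf and to which nothing else is attached.  Almost all trees have linearly many
of them, while their maximum degree is a small fraction of [n]; these are the
only properties of the tree that the strategy uses.

Maker first embeds the core, that is, everything except the lower eleven vertices
of the pendant paths ([core_win]).  A vertex which is embedded but lacks a child,
or which is not yet used, can be served as long as Breaker has not claimed too
many edges at it.  Vertices with many Breaker edges are dealt with at once: a
vertex of the core by embedding its children ([single_step]), an unused one by a
manoeuvre of three moves that forces it into the tree ([danger_step]).  Breaker
can make only boundedly many vertices dangerous, and each costs a small fraction
of [n] moves, so that all other degrees remain small and most pendant paths
survive.

When the core is complete, the unused vertices are distributed among the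
remaining pendant paths so that Breaker has no edge inside any group
([clean_assignment]).  From then on Maker answers in the group in which Breaker
has just moved ([mwin_family]).  In a group she has to find a Hamilton path from
a prescribed vertex of a complete graph on twelve vertices, moving second
([local_game]).  She builds up short paths and joins them at their ends; each
join takes two ends out of the game, with all Breaker edges at them, and she can
always choose ends that destroy more edges than Breaker has added
([join_kills2], [join_kills3]).

Labeled trees correspond to parent functions ([labeled_treesE]), and the two
properties of almost all trees are proved by switchings that change the parent of
one vertex.  Hanging a vertex below a sibling of it can be undone from the result
and the vertex alone, so pairs of siblings are few on average
([sum_siblings]), which bounds the degrees.  If there were few leaves, hanging an
only child elsewhere would create one of few leaves in very many ways
([card_few_leaves]); if there were few pendant paths of some length, hanging a
leaf below a shorter one would create one of few in very many ways
([card_few_pendant]). *)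

(** * Zero-waste games *)

Section Game.
Variable X : finType.
Implicit Types (E M B : {set X}) (goal : {set X} -> Prop).

(** Maker wins from the position [(M, B)], with Breaker to move, in exactly [k]
moves of her own.  Breaker may pass: seen from one board [E] of several, a move
on another board is a pass. *)
Fixpoint mwin E goal k M B : Prop :=
  if k is k'.+1 then
    forall B', B \subset B' -> #|B'| <= #|B|.+1 -> [disjoint B' & M] ->
      exists e, [/\ e \in E, e \notin M, e \notin B' & mwin E goal k' (e |: M) B']
  else goal M.

Lemma mwin_impl E goal goal' k M B :
  (forall M', M \subset M' -> goal M' -> goal' M') ->
  mwin E goal k M B -> mwin E goal' k M B.
Proof.
elim: k M B => [|k IH] M B imp /=; first exact: imp.
move=> win B' sB cB dB; have [e [eE eM eB w]] := win B' sB cB dB.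
exists e; split=> //; apply: IH w => M' sM; apply: imp.
by apply: subset_trans sM; apply: subsetUr.
Qed.

Lemma card_setU1_le (A : {set X}) x : #|x |: A| <= #|A|.+1.
Proof. by rewrite cardsU1; case: (x \notin A). Qed.

Lemma index_rcons_in (h : seq X) x y : y \in h -> index y (rcons h x) = index y h.
Proof. by move=> yh; rewrite -cats1 index_cat yh. Qed.

Definition claimed b (h : seq X) : {set X} := [set x in h | odd (index x h) == b].

Lemma claimed_rcons b (h : seq X) x : x \notin h ->
  claimed b (rcons h x) = if odd (size h) == b then x |: claimed b h else claimed b h.
Proof.
move=> xh; apply/setP=> y; rewrite !inE mem_rcons inE.
have [->|yx] := eqVneq y x.
  rewrite -cats1 index_cat (negbTE xh) /= eqxx addn0.
  by case: ifP => E; rewrite !inE ?eqxx ?(negbTE xh).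
case: ifP => _; rewrite !inE ?(negbTE yx) /=; case yh: (y \in h) => //=;
  by rewrite index_rcons_in.
Qed.

Lemma claimedU (h : seq X) x : (x \in h) = (x \in claimed true h :|: claimed false h).
Proof. by rewrite !inE -andb_orr; case: (odd _); rewrite ?andbT. Qed.

Lemma claimed_disj (h : seq X) : [disjoint claimed false h & claimed true h].
Proof.
by apply/pred0P=> x /=; rewrite !inE; case: (x \in h) => //=; case: odd.
Qed.

Lemma claimed_true h : claimed true h = maker_claimed h.
Proof. by apply/setP=> x; rewrite !inE eqb_id. Qed.

(** A strategy sees only the history, which determines the position: at each of
her turns Maker looks for a move to a winning position.  Breaker cannot be forced
to pass on the way, since a pass would still leave Maker a free element. *)
Lemma mwin_maker_wins (F : {set {set X}}) goal k :
  (forall M, goal M -> exists2 W, W \in F & W \subset M) ->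
  mwin setT goal k set0 set0 -> maker_wins_in F k.
Proof.
move=> goalF win0.
pose good (h : seq X) x := x \notin h /\
  mwin setT goal (k - (size h)./2.+1) (x |: claimed true h) (claimed false h).
have /boolp.choice[maker Hm] : forall h, exists o : option X,
    match o with
    | Some x => x \notin h /\ ((exists y, good h y) -> good h x)
    | None => forall x, x \in h
    end.
  move=> h.
  have [[y gy]|ng] := pselect (exists y, good h y).
    by exists (Some y); split=> //; case: gy.
  have [[x xh]|nx] := pselect (exists x, x \notin h).
    by exists (Some x); split=> // /ng.
  by exists None => x; apply/negPn/negP=> xh; apply: nx; exists x.
exists maker => [h|breaker legB].
  by have := Hm h; case: (maker h) => // x [].
suff H j : j <= k -> size (play maker breaker j.*2) = j.*2 /\
   mwin setT goal (k - j) (claimed true (play maker breaker j.*2))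
      (claimed false (play maker breaker j.*2)).
  have [_] := H k (leqnn k); rewrite subnn /= => /goalF[W WF sW].
  by exists W => //; rewrite -claimed_true.
elim: j => [_|j IH jk].
  have c0 b : claimed b [::] = set0 by apply/setP=> x; rewrite !inE.
  by split; [|rewrite subn0 [play _ _ _]/= !c0].
have [sz win] := IH (ltnW jk).
set h := play maker breaker j.*2 in sz win.
have Ek : k - j = (k - j.+1).+1 by lia.
rewrite Ek in win.
rewrite doubleS [play _ _ _]/= odd_double /= -/h.
have := legB h; case Eb: (breaker h) => [b|] hb; last first.
  have [|e [_ eM eB _]] := win (claimed false h) (subxx _) (leqnSn _).
    exact: claimed_disj.
  by have := hb e; rewrite claimedU inE (negbTE eM) (negbTE eB).
set h1 := rcons h b.
have szh1 : size h1 = j.*2.+1 by rewrite size_rcons sz.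
have cT : claimed true h1 = claimed true h by rewrite claimed_rcons // sz odd_double.
have cF : claimed false h1 = b |: claimed false h
  by rewrite claimed_rcons // sz odd_double.
have [|||e [_ eM eB w]] := win (claimed false h1).
- by rewrite cF subsetUr.
- by rewrite cF card_setU1_le.
- by rewrite -cT claimed_disj.
have ge : good h1 e.
  split; first by rewrite claimedU cT inE negb_or eM eB.
  by rewrite szh1 /= uphalf_double cT.
have := Hm h1; case: (maker h1) => [x [xh1 /(_ (ex_intro _ _ ge)) [_ gx]]|]; last first.
  by move=> /(_ e); have [/negbTE-> _] := ge.
rewrite size_rcons szh1; split=> //.
rewrite (claimed_rcons true xh1) (claimed_rcons false xh1) szh1 /= odd_double /=.
by move: gx; rewrite szh1 /= uphalf_double.
Qed.

(** Games on disjoint boards can be played simultaneously: Maker answers on the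
board on which Breaker has just moved, and treats a move elsewhere as a pass. *)
Lemma mwin_family (I : finType) (E : I -> {set X}) (goal : I -> {set X} -> Prop)
    (k : I -> nat) M B :
  (forall i j, i != j -> [disjoint E i & E j]) ->
  (forall i, mwin (E i) (goal i) (k i) (M :&: E i) (B :&: E i)) ->
  mwin setT (fun M' => forall i, goal i (M' :&: E i)) (\sum_i k i) M B.
Proof.
move=> dE; move Es: (\sum_i k i) => s.
elim: s k M B Es => [|s IH] k M B Es win /=.
  move=> i; have := win i; suff -> : k i = 0 by [].
  by apply/eqP; have := sum_nat_eq0 xpredT k; rewrite Es eqxx => /esym/forallP/(_ i).
move=> B' sB cB dB.
have [i0 i0k] : exists i, 0 < k i.
  apply/existsP; rewrite -[[exists _, _]]negbK negb_exists.
  by apply/negP=> /forallP H; move: Es; rewrite big1 // => i _; have := H i; case: (k i).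
have [i ki Hi] : exists2 i, 0 < k i &
    forall j, 0 < k j -> j != i -> B' :&: E j = B :&: E j.
  have [/existsP[i /andP[ki /existsP[b /andP[bE /andP[bB' bB]]]]]|] :=
    boolP [exists i, (0 < k i) && [exists b, (b \in E i) && ((b \in B') && (b \notin B))]].
    exists i => // j kj ji; apply/setP=> x; rewrite !inE; apply: andb_id2r => xE.
    apply/idP/idP=> [xB'|/(subsetP sB)//]; apply/negPn/negP=> xB.
    have xb : x != b.
      apply/eqP=> xb; have := dE _ _ ji; move=> /pred0P/(_ x) /=.
      by rewrite xE xb bE.
    have : [set x; b] \subset B' :\: B.
      by apply/subsetP=> y; rewrite !inE => /orP[]/eqP->; rewrite ?xB' ?xB ?bB' ?bB.
    move/subset_leq_card; rewrite cards2 xb cardsD (setIidPr sB).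
    by move=> ?; lia.
  rewrite negb_exists => /forallP H; exists i0 => // j kj _.
  apply/setP=> x; rewrite !inE; apply: andb_id2r => xE.
  apply/idP/idP=> [xB'|/(subsetP sB)//]; apply/negPn/negP=> xB.
  have := H j; rewrite kj /= negb_exists => /forallP/(_ x).
  by rewrite xE xB' xB.
have := win i; case Eki: (k i) ki => [//|ki] _ /=.
move=> /(_ (B' :&: E i)) [||| e [eE eM eB w]].
- exact: setSI.
- have : #|(B' :\: B)| <= 1 by rewrite cardsD (setIidPr sB) leq_subLR addn1.
  have : (B' :&: E i) :\: (B :&: E i) \subset B' :\: B.
    by apply/subsetP=> x; rewrite !inE => /andP[]; case: (x \in E i); rewrite ?andbF ?andbT // => -> ->.
  move/subset_leq_card=> h1 h2; have := leq_trans h1 h2.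
  by rewrite cardsD (setIidPr (setSI _ sB)) leq_subLR addn1.
- by apply: disjointWr (subsetIl _ _) _; apply: disjointWl (subsetIl _ _) _.
have {}eM : e \notin M by move: eM; rewrite inE eE andbT.
have {}eB : e \notin B' by move: eB; rewrite inE eE andbT.
exists e; split=> //.
apply: (IH (fun j => if j == i then ki else k j)).
  have := Es; rewrite (bigD1 i) //= Eki addSn => [[<-]].
  rewrite (bigD1 i) //= eqxx; congr (_ + _); apply: eq_bigr => j /negbTE->//.
move=> j; case: ifP => [/eqP->|/negbT ji].
  suff -> : (e |: M) :&: E i = e |: M :&: E i by [].
  by apply/setP=> x; rewrite !inE; case: eqP => [->|]; rewrite ?eE.
have -> : (e |: M) :&: E j = M :&: E j.
  apply/setP=> x; rewrite !inE; case: eqP => [->|] //=.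
  by have /pred0P/(_ e) /= := dE _ _ ji; rewrite eE andbT (negbTE eM) => ->.
have := win j; have := Hi j; case: (k j) => [//|kj] -> //.
Qed.

End Game.

(** * Edges, adjacency and degrees *)

Section Edges.
Variable n : nat.
Implicit Types (G M B : {set edge n}) (x y u v : 'I_n) (S Z : {set 'I_n}).

Lemma edgeP x y : x != y -> exists e : edge n, val e = [set x; y].
Proof.
move=> xy; have H : #|[set x; y]| == 2 by rewrite cards2 xy.
by exists (exist (fun e : {set 'I_n} => #|e| == 2) _ H).
Qed.

Lemma edge_ends (e : edge n) : exists x y, x != y /\ val e = [set x; y].
Proof. by have /cards2P[x [y [xy E]]] : #|val e| == 2 := valP e; exists x, y; split. Qed.

Lemma adjP G x y : reflect (exists2 e, e \in G & val e = [set x; y]) (adj G x y).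
Proof.
by apply: (iffP existsP) => -[e]; [move=> /andP[eG /eqP]; exists e|
   move=> eG E; exists e; rewrite eG E eqxx].
Qed.

Lemma adj_sym G : symmetric (adj G).
Proof. by move=> x y; rewrite /adj; apply: eq_existsb => e; rewrite setUC. Qed.

Lemma adj_neq G x y : adj G x y -> x != y.
Proof.
by move=> /adjP[e _ E]; have := valP e; rewrite /= E cards2; case: (x != y).
Qed.

Lemma adj_irr G x : adj G x x = false.
Proof. by case E: (adj G x x) => //; have := adj_neq E; rewrite eqxx. Qed.

Lemma adj_val G x y (e : edge n) : val e = [set x; y] -> (e \in G) = adj G x y.
Proof.
move=> E; apply/idP/adjP => [eG|[e' eG E']]; first by exists e.
by suff -> : e = e' by []; apply: val_inj; rewrite E E'.
Qed.

Lemma set2_eq (T : finType) (a b x y : T) :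
  ([set a; b] == [set x; y]) = ((a == x) && (b == y)) || ((a == y) && (b == x)).
Proof.
apply/eqP/idP => [/setP E|/orP[]/andP[/eqP-> /eqP->] //]; last exact: setUC.
have := E a; have := E b; have := E x; have := E y; rewrite !inE !eqxx ?orbT ?orTb.
rewrite ![x == _]eq_sym ![y == _]eq_sym.
have [->|] := eqVneq a x; have [->|] := eqVneq b y => //=;
  have [?|] := eqVneq a y; have [?|] := eqVneq b x => //=; subst; rewrite ?eqxx //.
Qed.

Lemma adjU1 G (e : edge n) x y a b : val e = [set x; y] ->
  adj (e |: G) a b = (((a == x) && (b == y)) || ((a == y) && (b == x))) || adj G a b.
Proof.
move=> E; rewrite -set2_eq; apply/adjP/orP => [[e' /setU1P[->|eG] E']|].
- by left; rewrite -E -E'.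
- by right; apply/adjP; exists e'.
case=> [/eqP ab|/adjP[e' eG E']]; first by exists e; rewrite ?setU11 // E ab.
by exists e' => //; rewrite setU1r.
Qed.

Lemma adjS G G' x y : G \subset G' -> adj G x y -> adj G' x y.
Proof. by move=> /subsetP s /adjP[e /s eG E]; apply/adjP; exists e. Qed.

Lemma breaker_move B B' : B \subset B' -> #|B'| <= #|B|.+1 ->
  B' = B \/ exists x y, x != y /\ forall a b, adj B' a b =
    (((a == x) && (b == y)) || ((a == y) && (b == x))) || adj B a b.
Proof.
move=> sB cB; have [D0|[e eD]] := set_0Vmem (B' :\: B).
  by left; apply/eqP; rewrite eqEsubset sB -setD_eq0 D0 eqxx.
have E : B' = e |: B.
  apply/esym/eqP; rewrite eqEcard; apply/andP; split.
    by rewrite subUset sB andbT sub1set; move: eD; rewrite inE => /andP[].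
  by rewrite cardsU1; move: eD; rewrite inE => /andP[-> _].
have [x [y [xy Ee]]] := edge_ends e; right; exists x, y; split=> // a b.
by rewrite E (adjU1 _ _ _ Ee).
Qed.

End Edges.
(** * Choosing which two path ends to join *)

Section Degrees.
Variable V : finType.
Implicit Types (r : rel V) (Z : {set V}).

Definition dg r Z a := #|[set b in Z | r a b]|.

(** Twice the number of edges inside [Z]. *)
Definition edges2 r Z := \sum_(a in Z) dg r Z a.

Lemma dgE r Z a : dg r Z a = \sum_(b in Z) r a b.
Proof.
rewrite /dg -sum1_card big_mkcond [RHS]big_mkcond; apply: eq_bigr => b _.
by rewrite inE; case: (b \in Z); case: (r a b).
Qed.

Lemma dgS r r' Z Z' a : Z \subset Z' -> (forall b, r a b -> r' a b) ->
  dg r Z a <= dg r' Z' a.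
Proof.
move=> /subsetP sZ sr; apply/subset_leq_card/subsetP=> b.
by rewrite !inE => /andP[/sZ-> /sr].
Qed.

Lemma edges2S r Z Z' : Z \subset Z' -> edges2 r Z <= edges2 r Z'.
Proof.
move=> sZ; rewrite /edges2 [X in _ <= X](big_setID Z) /= (setIidPr sZ).
apply: leq_trans (leq_addr _ _); apply: leq_sum => a _.
exact: dgS.
Qed.

Lemma edges2_move r r' Z x y :
  (forall a b, r' a b = (((a == x) && (b == y)) || ((a == y) && (b == x))) || r a b) ->
  edges2 r' Z <= edges2 r Z + 2.
Proof.
move=> E; have one v : \sum_(a in Z) (a == v) <= 1.
  rewrite big_mkcond /= (bigD1 v) //= big1 => [|a /negbTE->]; last by case: ifP.
  by rewrite addn0 eqxx; case: ifP.
apply: (@leq_trans (\sum_(a in Z) (dg r Z a + (a == x) + (a == y)))); last first.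
  by rewrite !big_split /= -addnA leq_add2l (leq_add (one x) (one y)).
apply: leq_sum => a _; rewrite !dgE.
apply: (@leq_trans (\sum_(b in Z) (r a b + ((a == x) && (b == y)) + ((a == y) && (b == x))))).
  by apply: leq_sum => b _; rewrite E; do 2 case: (_ && _); case: (r a b).
rewrite !big_split /= -!addnA leq_add2l; apply: leq_add.
  by case: (a == x) => /=; [exact: one | rewrite big1].
by case: (a == y) => /=; [exact: one | rewrite big1].
Qed.

Section Sym.
Variable r : rel V.
Hypothesis r_sym : symmetric r.
Hypothesis r_irr : forall a, r a a = false.

Lemma edges2D1 Z a : a \in Z -> edges2 r Z = edges2 r (Z :\ a) + (dg r Z a).*2.
Proof.
move=> aZ; rewrite /edges2 (big_setD1 a) //=.
have E c : dg r Z c = r c a + dg r (Z :\ a) c.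
  by rewrite !dgE (big_setD1 a) //=.
rewrite (eq_bigr (fun c => r a c + dg r (Z :\ a) c)); last first.
  by move=> c _; rewrite E r_sym.
by rewrite big_split /= -dgE; have := E a; rewrite r_irr add0n; lia.
Qed.

Lemma edges2_even Z : ~~ odd (edges2 r Z).
Proof.
move Em: #|Z| => m; elim: m Z Em => [|m IH] Z Em.
  by rewrite (cards0_eq Em) /edges2 big_set0.
have [Z0|[a aZ]] := set_0Vmem Z; first by rewrite Z0 cards0 in Em.
rewrite (edges2D1 aZ) oddD odd_double addbF; apply: IH.
by move: Em; rewrite (cardsD1 a) aZ => -[].
Qed.

Lemma edges2D2 Z a b : a \in Z -> b \in Z -> a != b -> ~~ r a b ->
  edges2 r (Z :\ a :\ b) + (dg r Z a).*2 + (dg r Z b).*2 = edges2 r Z.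
Proof.
move=> aZ bZ ab rab; rewrite (edges2D1 aZ) (@edges2D1 (Z :\ a) b); last first.
  by rewrite !inE eq_sym ab.
suff -> : dg r (Z :\ a) b = dg r Z b by lia.
rewrite [RHS]dgE (big_setD1 a) //= r_sym (negbTE rab) add0n -dgE.
by [].
Qed.

Section Select.
Variables (same : rel V) (Z : {set V}).
Hypothesis partner : forall a, a \in Z ->
  exists p, forall b, b \in Z -> same a b -> b = a \/ b = p.

Definition joinable a b := [&& a \in Z, b \in Z, a != b, ~~ same a b & ~~ r a b].

Lemma joinable_card a (P : pred V) : a \in Z -> (forall b, joinable a b -> ~~ P b) ->
  #|[set b in Z | P b]| <= dg r Z a + 2.
Proof.
move=> aZ H; have [p Hp] := partner aZ.
apply: (@leq_trans #|[set b in Z | r a b] :|: [set a; p]|); last first.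
  apply: leq_trans (leq_card_setU _ _) _; rewrite leq_add2l cards2.
  by case: (a != p).
apply/subset_leq_card/subsetP=> b; rewrite !inE => /andP[bZ Pb].
rewrite bZ /=; apply/negPn/negP; rewrite !negb_or => /andP[rab /andP[ba bp]].
have := H b; rewrite /joinable aZ bZ rab eq_sym ba Pb andbT /= => H'.
have sab : same a b by apply/negPn/negP=> /H'.
by have [E|E] := Hp b bZ sab; rewrite E eqxx in ba bp.
Qed.

Lemma joinable_any a : a \in Z -> dg r Z a + 2 < #|Z| -> exists b, joinable a b.
Proof.
move=> aZ lt; apply/existsP; rewrite -[[exists _, _]]negbK negb_exists.
apply/negP=> /forallP H; have := @joinable_card a predT aZ.
have -> : [set b in Z | predT b] = Z by apply/setP=> b; rewrite !inE andbT.
move=> /(_ _) H'; have : #|Z| <= dg r Z a + 2; last by lia.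
by apply: H' => b jb; have := H b; rewrite jb.
Qed.

Lemma joinable_deg a d : a \in Z -> (forall b, b \in Z -> dg r Z b <= d) ->
  (forall b, joinable a b -> dg r Z b = 0) -> edges2 r Z <= (dg r Z a + 2) * d.
Proof.
move=> aZ le H.
have := @joinable_card a (fun b => 0 < dg r Z b) aZ.
move=> /(_ _) H1; have {}H1 : #|[set b in Z | 0 < dg r Z b]| <= dg r Z a + 2.
  by apply: H1 => b /H->.
apply: leq_trans (leq_mul H1 (leqnn d)).
rewrite -sum_nat_const /edges2 (big_setID [set b in Z | 0 < dg r Z b]) /=.
have -> : Z :&: [set b in Z | 0 < dg r Z b] = [set b in Z | 0 < dg r Z b].
  by apply/setP=> b; rewrite !inE; case: (b \in Z).
rewrite [X in _ + X]big1 ?addn0; last first.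
  by move=> b; rewrite !inE => /andP[h bZ]; move: h; rewrite bZ /=; lia.
by apply: leq_sum => b; rewrite inE => /andP[/le].
Qed.

Lemma edges2_max : 0 < edges2 r Z -> exists2 a, a \in Z &
  0 < dg r Z a /\ forall b, b \in Z -> dg r Z b <= dg r Z a.
Proof.
move=> pos; have [Z0|[a0 a0Z]] := set_0Vmem Z.
  by rewrite Z0 /edges2 big_set0 in pos.
case: (@arg_maxnP _ a0 (mem Z) (dg r Z) a0Z) => a aZ max.
exists a => //; split; last by move=> b /max.
rewrite lt0n; apply/eqP=> d0; move: pos; rewrite /edges2 big1 // => b bZ.
by apply/eqP; rewrite -leqn0 -d0; apply: max.
Qed.

(** Joining two ends turns both into inner vertices, which removes all edges at
them.  With at most [q] edges among [2q+1] ends all but [q-2] can be removed: either some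
end has degree two, or the edges form a matching and cannot all touch one end,
its partner or its neighbour. *)
Lemma join_kills2 q : #|Z| = q.*2.+1 -> 2 <= q -> edges2 r Z <= q.*2 ->
  exists a b, joinable a b /\ edges2 r (Z :\ a :\ b) <= (q - 2).*2.
Proof.
move=> cZ q2 le.
have kill a b : joinable a b -> edges2 r (Z :\ a :\ b) + (dg r Z a).*2 + (dg r Z b).*2 = edges2 r Z.
  by case/and5P=> aZ bZ ab _ rab; apply: edges2D2.
have dle a : a \in Z -> (dg r Z a).*2 <= q.*2.
  by move=> aZ; have := edges2D1 aZ; lia.
have [e0|pos] := posnP (edges2 r Z).
  have [Z0|[a aZ]] := set_0Vmem Z; first by rewrite Z0 cards0 in cZ.
  have [|b jb] := @joinable_any a aZ; first by have := dle a aZ; lia.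
  by exists a, b; split=> //; have := kill _ _ jb; lia.
have [a aZ [da max]] := edges2_max pos.
have [|b0 jb0] := @joinable_any a aZ; first by have := dle a aZ; lia.
have [d2|d1] := leqP 2 (dg r Z a).
  by exists a, b0; split=> //; have := kill _ _ jb0; lia.
have {d1}d1 : dg r Z a = 1 by lia.
have := edges2_even Z.
have [/existsP[b /andP[jb db]]|] := boolP [exists b, joinable a b && (0 < dg r Z b)].
  by exists a, b; split=> //; have := kill _ _ jb; lia.
rewrite negb_exists => /forallP H ev.
have := @joinable_deg a 1 aZ _ _; rewrite d1 => /(_ _ _) H'.
have {}H' : edges2 r Z <= 3.
  apply: H' => [b /max|b jb]; first by rewrite d1.
  by have := H b; rewrite jb; lia.
have e2 : edges2 r Z = 2 by move: H' ev pos; case: (edges2 r Z) => [|[|[|[|?]]]].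
by exists a, b0; split=> //; have := kill _ _ jb0; lia.
Qed.

(** With more edges than a matching can have, three of them can be removed. *)
Lemma join_kills3 q : #|Z| = q.*2.+1 -> 4 <= q -> q.*2 < edges2 r Z ->
  edges2 r Z <= (q.*2 - 3).*2 ->
  exists a b, joinable a b /\ edges2 r (Z :\ a :\ b) <= (q.*2 - 6).*2.
Proof.
move=> cZ q4 gt le.
have kill a b : joinable a b -> edges2 r (Z :\ a :\ b) + (dg r Z a).*2 + (dg r Z b).*2 = edges2 r Z.
  by case/and5P=> aZ bZ ab _ rab; apply: edges2D2.
have [|a aZ [da max]] := edges2_max; first by lia.
have dle : (dg r Z a).*2 <= (q.*2 - 3).*2 by have := edges2D1 aZ; lia.
have [|b0 jb0] := @joinable_any a aZ; first by lia.
have [d3|d2] := leqP 3 (dg r Z a).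
  by exists a, b0; split=> //; have := kill _ _ jb0; lia.
have ev := edges2_even Z.
have ed : edges2 r Z <= #|Z| * dg r Z a.
  by rewrite -sum_nat_const; apply: leq_sum => b; apply: max.
have {d2}d2 : dg r Z a = 2.
  suff: dg r Z a != 1 by lia.
  apply/eqP=> d1; rewrite d1 cZ muln1 in ed.
  have E : edges2 r Z = q.*2.+1 by lia.
  by rewrite E /= odd_double in ev.
have [/existsP[b /andP[jb db]]|] := boolP [exists b, joinable a b && (0 < dg r Z b)].
  by exists a, b; split=> //; have := kill _ _ jb; lia.
rewrite negb_exists => /forallP H.
have := @joinable_deg a 2 aZ _ _; rewrite d2 => /(_ _ _) H'.
suff : edges2 r Z <= 8 by lia.
apply: H' => [b /max|b jb]; first by rewrite d2.
by have := H b; rewrite jb; lia.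
Qed.

End Select.
End Sym.
End Degrees.

(** * The local game: a Hamilton path from a given vertex *)

Section Local.
Variables (n : nat) (u : 'I_n) (S : {set 'I_n}).
Local Notation V := 'I_n.
Implicit Types (M B : {set edge n}) (m c : seq V) (cs ps : seq (seq V)).

Definition inside (Z : {set V}) : {set edge n} := [set e : edge n | val e \subset Z].

Definition ham_path M := exists s, [/\ perm_eq s (enum S) & path (adj M) u s].

(** Maker's graph is a union of disjoint paths covering [u |: S]: the path [m]
starting at [u], and the paths in [cs]. *)
Definition paths M m cs :=
  [/\ exists t, m = u :: t, all (fun c => 0 < size c) cs,
      all (sorted (adj M)) (m :: cs) & perm_eq (m ++ flatten cs) (u :: enum S)].

Definition ends c := [:: head u c; last u c].

Definition all_ends m cs := last u m :: flatten [seq ends c | c <- cs].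

Definition same_path cs : rel V :=
  fun a b => has (fun c => (a \in ends c) && (b \in ends c)) cs.

Lemma sorted_rev_adj M c : sorted (adj M) (rev c) = sorted (adj M) c.
Proof. by rewrite rev_sorted; apply: eq_sorted => x y; apply: adj_sym. Qed.

Lemma ends_rev c : 0 < size c -> ends (rev c) = rev (ends c).
Proof.
by case: c => // x c _; rewrite /ends; case/lastP: c => [|c y] //;
  rewrite rev_cons rev_rcons /= !last_rcons.
Qed.

Lemma ends_sub c : 0 < size c -> {subset ends c <= c}.
Proof.
case: c => // x c _ y; rewrite 2!in_cons in_nil orbF => /orP[]/eqP->; first exact: mem_head.
exact: (mem_last x c).
Qed.

Lemma head_in c : 0 < size c -> head u c \in c.
Proof. by move=> c0; apply: ends_sub => //; rewrite in_cons eqxx. Qed.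

Lemma last_in c : 0 < size c -> last u c \in c.
Proof. by move=> c0; apply: ends_sub => //; rewrite !in_cons eqxx orbT. Qed.

Lemma all_ends_cons m c cs : all_ends m (c :: cs) =
  last u m :: (ends c ++ flatten [seq ends d | d <- cs]).
Proof. by []. Qed.

Lemma all_ends_perm m cs cs' : perm_eq cs cs' ->
  perm_eq (all_ends m cs) (all_ends m cs').
Proof. by move=> p; rewrite perm_cons; apply/perm_flatten/perm_map. Qed.

Lemma paths_perm M m cs cs' : perm_eq cs cs' -> paths M m cs -> paths M m cs'.
Proof.
move=> p [h1 h2 h3 h4]; split=> //.
- by rewrite -(perm_all _ p).
- by rewrite /= -(perm_all _ p).
- by apply: perm_trans h4; rewrite perm_cat2l perm_sym; apply: perm_flatten.
Qed.

Lemma paths_rev M m c cs : paths M m (c :: cs) -> paths M m (rev c :: cs).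
Proof.
move=> [h1 h2 h3 h4]; split=> //=.
- by rewrite size_rev.
- by rewrite sorted_rev_adj.
- by apply: perm_trans h4; rewrite perm_cat2l /= perm_cat2r perm_rev.
Qed.

Lemma pathsS M M' m cs : M \subset M' -> paths M m cs -> paths M' m cs.
Proof.
move=> sM [h1 h2 h3 h4]; split=> //; apply: sub_all h3 => c; apply: sub_sorted => x y.
exact: adjS.
Qed.

Lemma sorted_cat_adj M c c' : 0 < size c -> 0 < size c' ->
  sorted (adj M) c -> sorted (adj M) c' -> adj M (last u c) (head u c') ->
  sorted (adj M) (c ++ c').
Proof.
by case: c c' => // x c [|y c'] // _ _ /= p1 p2 a; rewrite cat_path p1 /= a.
Qed.

Lemma paths_join M m c c' cs : paths M m (c :: c' :: cs) ->
  adj M (last u c) (head u c') -> paths M m ((c ++ c') :: cs).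
Proof.
move=> [h1 /= /and3P[s1 s2 h2] /and4P[h3 o1 o2 h3'] h4] a; split=> //=.
- by rewrite size_cat addn_gt0 s1.
- by rewrite h3 h3' sorted_cat_adj.
- by rewrite -catA.
Qed.

Lemma paths_join_main M m c cs : paths M m (c :: cs) ->
  adj M (last u m) (head u c) -> paths M (m ++ c) cs.
Proof.
move=> [[t ->] /= /andP[s1 h2] /and3P[h3 o1 h3'] h4] a; split=> //=.
- by exists (t ++ c).
- by rewrite h3' andbT; apply: (@sorted_cat_adj _ (u :: t)).
- by rewrite -catA.
Qed.

Lemma flatten_ends_sub cs : all (fun c => 1 < size c) cs ->
  {subset flatten [seq ends c | c <- cs] <= flatten cs}.
Proof.
move=> big x /flatten_mapP[c cC xc]; apply/flattenP; exists c => //.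
by apply: ends_sub xc; have := allP big _ cC; case: (size c).
Qed.

Lemma flatten_ends_uniq cs : all (fun c => 1 < size c) cs ->
  uniq (flatten cs) -> uniq (flatten [seq ends c | c <- cs]).
Proof.
elim: cs => //= c cs IH /andP[sc big]; rewrite cat_uniq => /and3P[Uc /hasPn dc Ucs].
have s0 : 0 < size c by apply: ltnW.
rewrite (IH big Ucs) andbT inE; apply/andP; split.
  rewrite negb_or; apply/andP; split.
    case: c sc Uc {dc s0} => [|x [|y c]] //= _ /andP[/memPn h _].
    by rewrite eq_sym; apply: h; apply: mem_last.
  apply/negP=> /(flatten_ends_sub big)/dc.
  by rewrite ends_sub ?mem_head.
apply/negP=> /(flatten_ends_sub big)/dc.
by rewrite ends_sub // !inE eqxx orbT.
Qed.

Lemma paths_uniq M m cs : u \notin S -> paths M m cs ->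
  all (fun c => 1 < size c) cs -> uniq (all_ends m cs).
Proof.
move=> uS [[t Em] _ _ /perm_uniq]; rewrite /= mem_enum uS enum_uniq /= => U big.
move: U; rewrite cat_uniq => /and3P[_ /hasPn dm U].
rewrite flatten_ends_uniq // andbT.
by apply/negP=> /(flatten_ends_sub big)/dm; rewrite Em /= mem_last.
Qed.

Lemma size_all_ends m cs : size (all_ends m cs) = (size cs).*2.+1.
Proof. by rewrite /=; congr _.+1; elim: cs => //= c cs ->. Qed.

(** The paths of [L] may have been merged into those of [L']. *)
Definition coarser (L L' : seq (seq V)) :=
  forall c, c \in L -> exists2 d, d \in L' & {subset c <= d}.

Lemma coarser_trans L1 L2 L3 : coarser L1 L2 -> coarser L2 L3 -> coarser L1 L3.
Proof.
move=> h1 h2 c /h1[d /h2[d' d'L s'] s]; exists d' => // x /s/s'//.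
Qed.

Lemma coarser_cons c L L' : coarser L L' -> coarser (c :: L) (c :: L').
Proof.
move=> h d; rewrite in_cons => /orP[/eqP->|/h[d' d'L s]]; first by exists c; rewrite ?mem_head.
by exists d'; rewrite // in_cons d'L orbT.
Qed.

Arguments coarser_trans {L1 L2 L3} _ _.
Arguments coarser_cons c {L L'} _.

Lemma coarser_join c c' d cs : {subset c <= d} -> {subset c' <= d} ->
  coarser [:: c, c' & cs] (d :: cs).
Proof.
move=> s s' x; rewrite !in_cons => /or3P[/eqP->|/eqP->|xc].
- by exists d; rewrite ?mem_head.
- by exists d; rewrite ?mem_head.
- by exists x; rewrite // in_cons xc orbT.
Qed.

(** Permuting the paths and reversing them does not change the position, so the
end to be used next may be assumed to come first.  The prefix [pre] allows this to
be done for two ends one after the other. *)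
Lemma pick_end m cs b : all (fun c => 1 < size c) cs ->
  b \in flatten [seq ends c | c <- cs] ->
  exists c cs', [/\ head u c = b, 1 < size c, perm_eq (all_ends m cs) (all_ends m (c :: cs')),
     forall M pre, paths M m (pre ++ cs) -> paths M m (pre ++ c :: cs') &
     [/\ forall a, a \in ends c -> same_path cs a b, coarser cs (c :: cs'),
      all (fun c => 1 < size c) cs' & size cs = (size cs').+1]].
Proof.
move=> big /flatten_mapP[c cC bc].
have sc := allP big _ cC; have sc0 : 0 < size c by apply: ltnW.
have p := perm_to_rem cC.
have big' : all (fun c => 1 < size c) (rem c cs).
  by move: big; rewrite (perm_all _ p) => /andP[].
have ss : size cs = (size (rem c cs)).+1 by rewrite (perm_size p).
have co d : {subset c <= d} -> coarser cs (d :: rem c cs).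
  move=> s x; rewrite (perm_mem p) in_cons => /orP[/eqP->|xr].
    by exists d; rewrite ?mem_head.
  by exists x; rewrite // in_cons xr orbT.
have sm a : a \in ends c -> same_path cs a b by move=> ac; apply/hasP; exists c; rewrite ?ac.
move: bc; rewrite !inE => /orP[]/eqP Eb.
  exists c, (rem c cs); split=> //; first exact: all_ends_perm.
    by move=> M pre; apply: paths_perm; rewrite perm_cat2l.
  by split=> //; apply: co.
exists (rev c), (rem c cs); split=> //.
- have := ends_rev sc0; rewrite /ends => -[-> _]; exact: esym.
- by rewrite size_rev.
- apply: perm_trans (all_ends_perm m p) _.
  by rewrite !all_ends_cons perm_cons ends_rev // perm_cat2r perm_sym perm_rev.
- move=> M pre st.
  have q : perm_eq (pre ++ cs) (c :: (pre ++ rem c cs)).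
    apply: (@perm_trans _ (pre ++ c :: rem c cs)); first by rewrite perm_cat2l.
    by rewrite perm_catC /= perm_cons perm_catC.
  have := paths_rev (paths_perm q st); apply: paths_perm.
  by rewrite perm_sym perm_catC /= perm_cons perm_catC.
- split=> // [a|]; first by rewrite ends_rev // mem_rev; apply: sm.
  by apply: co => x; rewrite mem_rev.
Qed.

Lemma same_path_partner M m cs : u \notin S -> paths M m cs ->
  all (fun c => 1 < size c) cs -> forall a, a \in [set x in all_ends m cs] ->
  exists p, forall b, b \in [set x in all_ends m cs] -> same_path cs a b -> b = a \/ b = p.
Proof.
move=> uS st big a _; have := paths_uniq uS st big; rewrite /all_ends /= => /andP[_].
elim: cs big {st} => [|c cs IH] big U; first by exists a.
move: U; rewrite (_ : flatten _ = ends c ++ flatten [seq ends d | d <- cs]) // cat_uniq => /and3P[_ dc U].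
have := IH _ U; case/andP: big => _ big /(_ big) [p Hp].
have [ac|ac] := boolP (a \in ends c).
  exists (if a == head u c then last u c else head u c) => b _ /=.
  case/orP=> [/andP[_ ]|].
    move: ac; rewrite !inE; case: (eqVneq a (head u c)) => [->|] /=.
      by move=> _ /orP[]/eqP->; [left|right].
    by move=> _ /eqP-> /orP[]/eqP->; [right|left].
  case/hasP=> c' cC /andP[ac' _]; move/hasPn: dc => /(_ a).
  by rewrite ac => H; have /H : a \in flatten [seq ends c | c <- cs];
    first by apply/flatten_mapP; exists c'.
exists p => b bZ; rewrite /= (negbTE ac) /= => sb; apply: Hp => //.
move: sb => /hasP[c' cC /andP[_ bc]]; rewrite inE in_cons; apply/orP; right.
by apply/flatten_mapP; exists c'.
Qed.

(** Both ends of the new edge become inner vertices; the remaining two ends of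
the joined paths stay ends.  The last clause keeps track of where Maker's edges
lie, so that no edge is ever claimed twice. *)
Lemma join_ends M m cs a b : u \notin S -> paths M m cs ->
  all (fun c => 1 < size c) cs ->
  a \in all_ends m cs -> b \in all_ends m cs -> a != b -> ~~ same_path cs a b ->
  exists m' cs', [/\ forall M', M \subset M' -> adj M' a b -> paths M' m' cs',
     all (fun c => 1 < size c) cs', size cs = (size cs').+1,
     {subset all_ends m' cs' <= [set x in all_ends m cs] :\ a :\ b} &
     coarser (m :: cs) (m' :: cs') /\
     exists2 c, c \in m' :: cs' & (a \in c) && (b \in c)].
Proof.
move=> uS st big; have U := paths_uniq uS st big.
wlog : a b / b != last u m.
  move=> H aZ bZ ab sab; have [E|bm] := eqVneq b (last u m); last exact: H.
  have [|||m' [cs' [h1 h2 h3 h4 [h5 [c cL abc]]]]] := H b a _ bZ aZ _ _.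
  - by rewrite -E.
  - by rewrite eq_sym.
  - by apply: contra sab => /hasP[c cC ?]; apply/hasP; exists c => //; rewrite andbC.
  exists m', cs'; split=> // [M' sM aM|x /h4|].
    by apply: h1 => //; rewrite adj_sym.
    by rewrite !inE andbCA.
  by split=> //; exists c => //; rewrite andbC.
move=> bm aZ; rewrite in_cons (negbTE bm) /= => bZ ab sab.
have [c [cs1 [Eb sc pe stc [sm co1 big1 sz]]]] := pick_end m big bZ.
have {}aZ : a \in all_ends m (c :: cs1) by rewrite -(perm_mem pe).
have {}U : uniq (all_ends m (c :: cs1)) by rewrite -(perm_uniq pe).
have Z x : x \in all_ends m cs = (x \in all_ends m (c :: cs1)) by rewrite (perm_mem pe).
have c0 : 0 < size c by apply: ltnW.
have lastc x0 s : last x0 (s ++ c) = last u c.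
  by rewrite last_cat; case: (c) c0.
move: aZ; rewrite all_ends_cons in_cons => /orP[/eqP Ea|aZ].
  have m0 : 0 < size m by case: (st) => -[t ->].
  exists (m ++ c), cs1; split=> // [M' sM aM|x|]; last first.
  - split.
      have co3 : coarser [:: m, c & cs1] ((m ++ c) :: cs1).
        by apply: coarser_join => x xc; rewrite mem_cat xc ?orbT.
      exact: (coarser_trans (coarser_cons m co1) co3).
    exists (m ++ c); rewrite ?mem_head // !mem_cat Ea -Eb.
    by rewrite last_in // head_in // orbT.
  - rewrite !in_setD1 in_set Z /all_ends lastc !in_cons /=.
    move: U; rewrite /all_ends /= !in_cons -Ea Eb !negb_or.
    case/andP=> /and3P[ab' alc a1] /and3P[/andP[bl b1] l1 _].
    case/orP=> [/eqP->|x1].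
      by rewrite eq_sym bl eq_sym alc eqxx !orbT.
    rewrite x1 !orbT andbT; apply/andP; split.
      by apply: contraNneq b1 => <-.
    by apply: contraNneq a1 => <-.
  - apply: paths_join_main; first by apply: pathsS sM _; apply: (stc _ [::]).
    by rewrite -Ea Eb.
have ac : a \notin ends c by apply: contra sab => /sm.
have {}aZ : a \in flatten [seq ends c | c <- cs1].
  by move: aZ; rewrite mem_cat (negbTE ac).
have [d [cs2 [Ea sd pe2 std [_ co2 big2 sz2]]]] := pick_end m big1 aZ.
have p2 : perm_eq (all_ends m (c :: cs1)) (all_ends m [:: c, d & cs2]).
  rewrite /all_ends /= perm_cons !perm_cons.
  by move: pe2; rewrite perm_cons.
have {}U : uniq (all_ends m [:: c, d & cs2]) by rewrite -(perm_uniq p2).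
have d0 : 0 < size d by apply: ltnW.
exists m, ((rev c ++ d) :: cs2); split=> [M' sM aM| | |x|]; last first.
- split.
    have co3 : coarser [:: c, d & cs2] ((rev c ++ d) :: cs2).
      by apply: coarser_join => y yc; rewrite mem_cat ?mem_rev yc ?orbT.
    have co4 := coarser_trans (coarser_cons c co2) co3.
    exact: (coarser_cons m (coarser_trans co1 co4)).
  exists (rev c ++ d); rewrite ?in_cons ?eqxx ?orbT // !mem_cat !mem_rev -Eb -Ea.
  by rewrite !head_in // orbT.
- have -> : all_ends m ((rev c ++ d) :: cs2) =
      [:: last u m, last u c, last u d & flatten [seq ends c | c <- cs2]].
    rewrite /all_ends /= last_cat; case: (d) d0 => //= y d' _.
    case/lastP: (c) c0 => // c' y' _; by rewrite rev_rcons /= last_rcons.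
  rewrite !in_setD1 in_set Z (perm_mem p2) /all_ends /=.
  move: U; rewrite /all_ends /= !in_cons Ea Eb !negb_or.
  case/andP=> /and5P[m1 m2 m3 m4 m5] /and3P[/and4P[b1 b2 b3 b4] /and3P[l1 l2 l3] /and3P[/andP[a1 a2] ll _]].
  case/or4P=> [/eqP->|/eqP->|/eqP->|x2].
  - by rewrite m1 m3 eqxx.
  - by rewrite eq_sym b1 l1 eqxx !orbT.
  - by rewrite eq_sym b3 eq_sym a1 eqxx !orbT.
  rewrite x2 !orbT andbT; apply/andP; split.
    by apply: contraNneq b4 => <-.
  by apply: contraNneq a2 => <-.
- by rewrite sz sz2.
- by rewrite /= size_cat size_rev big2 andbT; apply: leq_trans sc (leq_addr _ _).
have st' : paths M' m [:: rev c, d & cs2].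
  by apply/paths_rev/(std _ [:: c])/(stc _ [::])/(pathsS sM).
apply: paths_join st' _; have := ends_rev c0; rewrite /ends => -[_ ->].
by rewrite Ea Eb adj_sym.
Qed.

Definition linked M (L : seq (seq V)) :=
  forall a b, adj M a b -> exists2 c : seq V, c \in L & (a \in c) && (b \in c).

Definition pos M m cs := paths M m cs /\ linked M (m :: cs).

Definition long cs := all (fun c : seq V => 1 < size c) cs.

Lemma uniq_flatten_eq (L : seq (seq V)) c d x : uniq (flatten L) ->
  c \in L -> d \in L -> x \in c -> x \in d -> c = d.
Proof.
elim: L => //= c' L IH; rewrite cat_uniq => /and3P[_ /hasPn dj U].
have no e : e \in L -> x \in e -> x \in c' -> False.
  by move=> eL xe; apply/negP/dj/flattenP; exists e.
rewrite !in_cons => /orP[/eqP->|cL] /orP[/eqP->|dL] xc xd //.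
- by case: (no d).
- by case: (no c).
- exact: IH.
Qed.

Hypothesis uS : u \notin S.

Lemma paths_flatten_uniq M m cs : paths M m cs -> uniq (flatten (m :: cs)).
Proof. by case=> _ _ _ /perm_uniq->; rewrite /= mem_enum uS enum_uniq. Qed.

Lemma ends_path M m cs a : paths M m cs -> long cs -> a \in all_ends m cs ->
  exists c, [/\ c \in m :: cs, a \in ends c, a \in c & c \in cs \/ c = m /\ a = last u m].
Proof.
move=> [[t Em] _ _ _] big; rewrite in_cons => /orP[/eqP->|/flatten_mapP[c cC ac]].
  exists m; rewrite mem_head last_in ?Em //; split=> //; last by right.
  by rewrite !inE eqxx orbT.
exists c; rewrite in_cons cC orbT; split=> //; last by left.
by apply: ends_sub ac; have := allP big _ cC; case: (size c).
Qed.

Lemma all_ends_in M m cs a : paths M m cs -> long cs -> a \in all_ends m cs ->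
  a \in u |: S.
Proof.
move=> st big aZ; have [c [cL _ ac _]] := ends_path st big aZ.
have [_ _ _ /perm_mem p] := st; have : a \in flatten (m :: cs).
  by apply/flattenP; exists c.
by rewrite p !inE mem_enum.
Qed.

Lemma ends_not_adj M m cs a b : pos M m cs -> long cs ->
  a \in all_ends m cs -> b \in all_ends m cs -> a != b -> ~~ same_path cs a b ->
  ~~ adj M a b.
Proof.
move=> [st li] big aZ bZ ab sab; apply/negP=> /li[d dL /andP[ad bd]].
have U := paths_flatten_uniq st.
have [c [cL ae ac hc]] := ends_path st big aZ.
have [c' [c'L be bc hc']] := ends_path st big bZ.
have E : c = d by apply: (uniq_flatten_eq U cL dL ac).
have E' : c' = d by apply: (uniq_flatten_eq U c'L dL bc).
subst c c'; case: hc hc' => [dC|[dm am]] [dC'|[_ bm]].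
- by case/negP: sab; apply/hasP; exists d; rewrite ?ae.
- by case/negP: sab; apply/hasP; exists d; rewrite ?ae.
- by case/negP: sab; apply/hasP; exists d; rewrite ?ae.
- by rewrite am bm eqxx in ab.
Qed.

Lemma linked_setU1 M L L' (e : edge n) a b : val e = [set a; b] ->
  linked M L -> coarser L L' -> (exists2 c, c \in L' & (a \in c) && (b \in c)) ->
  linked (e |: M) L'.
Proof.
move=> Ee li co [c cL /andP[ac bc]] x y; rewrite (adjU1 _ _ _ Ee).
case/orP=> [/orP[]/andP[/eqP-> /eqP->]|/li[d /co[d' d'L s] /andP[xd yd]]].
- by exists c; rewrite // ac.
- by exists c; rewrite // bc.
- by exists d'; rewrite // !s.
Qed.

Notation board := (inside (u |: S)).

Lemma edge_inside a b (e : edge n) : val e = [set a; b] -> a \in u |: S ->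
  b \in u |: S -> e \in board.
Proof.
by move=> Ee aS bS; rewrite inE Ee; apply/subsetP=> x /set2P[]->.
Qed.

Lemma join_move M B m cs a b : pos M m cs -> long cs ->
  joinable (adj B) (same_path cs) [set x in all_ends m cs] a b ->
  exists e m' cs', [/\ e \in board, e \notin M, e \notin B,
    pos (e |: M) m' cs' & [/\ long cs', size cs = (size cs').+1 &
    edges2 (adj B) [set x in all_ends m' cs'] <=
    edges2 (adj B) ([set x in all_ends m cs] :\ a :\ b)]].
Proof.
move=> ps big /and5P[]; rewrite !inE => aZ bZ ab sab rab.
have [st li] := ps; have [e Ee] := edgeP ab.
have [m' [cs' [h1 h2 h3 h4 [h5 h6]]]] := join_ends uS st big aZ bZ ab sab.
exists e, m', cs'; split.
- by apply: (edge_inside Ee); apply: (all_ends_in st).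
- by rewrite (adj_val _ Ee); apply: (ends_not_adj ps).
- by rewrite (adj_val _ Ee).
- split; last exact: (linked_setU1 Ee li h5 h6).
  by apply: h1; [apply: subsetUr | rewrite (adjU1 _ _ _ Ee) !eqxx].
- split=> //; apply: edges2S; apply/subsetP=> x; rewrite inE; exact: h4.
Qed.

Lemma card_ends M m cs : paths M m cs -> long cs ->
  #|[set x in all_ends m cs]| = (size cs).*2.+1.
Proof.
move=> st big; rewrite cardsE (card_uniqP _) ?size_all_ends //.
exact: (paths_uniq uS st).
Qed.

Lemma edges2_breaker B B' Z : B \subset B' -> #|B'| <= #|B|.+1 ->
  edges2 (adj B') Z <= edges2 (adj B) Z + 2.
Proof.
move=> sB cB; have [->|[x [y [_ E]]]] := breaker_move sB cB; first by rewrite leq_addr.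
exact: edges2_move E.
Qed.

Lemma pos_done M m : pos M m [::] -> ham_path M.
Proof.
move=> [[[t ->] _ /= /andP[p _]]]; rewrite cats0 perm_cons => q _.
by exists t.
Qed.

(** Breaker adds one edge between ends, Maker's join removes two, and [q] drops
by one, so the bound survives each round.  For [q = 1] a single edge cannot block
both ends of the last path. *)
Lemma local_win q M B m cs : pos M m cs -> long cs -> size cs = q ->
  edges2 (adj B) [set x in all_ends m cs] <= (q - 1).*2 ->
  mwin board ham_path q M B.
Proof.
elim: q M B m cs => [|q IH] M B m cs ps big sz le.
  by move: ps; rewrite (size0nil sz) => /pos_done.
move=> B' sB cB _; set Z := [set x in all_ends m cs] in le *.
have le' : edges2 (adj B') Z <= q.*2 + 2.
  by apply: leq_trans (edges2_breaker Z sB cB) _; rewrite leq_add2r; lia.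
have [st _] := ps.
suff [a [b [jab le2]]] : exists a b, joinable (adj B') (same_path cs) Z a b /\
    edges2 (adj B') (Z :\ a :\ b) <= (q - 1).*2.
  have [e [m' [cs' [h1 h2 h3 h4 [h5 h6 h7]]]]] := join_move ps big jab.
  exists e; split=> //; apply: (IH _ _ m' cs') => //; last exact: leq_trans le2.
  by move: sz; rewrite h6 => -[].
have cZ : #|Z| = q.+1.*2.+1 by rewrite (card_ends st big) sz.
case: q {IH} sz le le' cZ => [|q] sz le le' cZ; last first.
  have := @join_kills2 _ (adj B') (@adj_sym _ _) (@adj_irr _ _) (same_path cs) Z
    (same_path_partner uS st big) q.+2 cZ isT.
  rewrite -[q.+2 - 2]/(q.+1 - 1) => H; apply: H; lia.
case: cs sz {le} @Z big ps st le' cZ => [//|c [|//]] _ Z /andP[sc _] ps st le' cZ.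
have := paths_uniq uS st; rewrite /long /= sc => /(_ isT) /andP[].
rewrite !in_cons !negb_or => /and3P[wh wl _] /andP[hl _].
have wZ : last u m \in Z by rewrite !inE eqxx.
have hZ : head u c \in Z by rewrite !inE eqxx orbT.
have lZ : last u c \in Z by rewrite !inE eqxx !orbT.
have dw := edges2D1 (@adj_sym _ B') (@adj_irr _ B') wZ.
have ns x : ~~ same_path [:: c] (last u m) x.
  by rewrite /= orbF /ends !inE (negbTE wh) (negbTE wl).
have c1 a b : a \in Z -> b \in Z -> a != b -> edges2 (adj B') (Z :\ a :\ b) <= 0.
  move=> aZ bZ ab; suff /eqP/cards1P[x ->] : #|Z :\ a :\ b| = 1.
    by rewrite /edges2 big_set1 dgE big_set1 adj_irr.
  have bZ' : b \in Z :\ a by rewrite in_setD1 bZ eq_sym ab.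
    by have := cZ; rewrite (cardsD1 a) aZ (cardsD1 b) bZ' !add1n => -[->].
have [h|h] := boolP (adj B' (last u m) (head u c)); last first.
  by exists (last u m), (head u c); rewrite c1 // /joinable wZ hZ wh ns h.
have [l|l] := boolP (adj B' (last u m) (last u c)); last first.
  by exists (last u m), (last u c); rewrite c1 // /joinable wZ lZ wl ns l.
have : 2 <= dg (adj B') Z (last u m).
  have <- : #|[set head u c; last u c]| = 2.
    by rewrite cards2; case/andP: hl => ->.
  by apply/subset_leq_card/subsetP=> x /set2P[]->; rewrite inE ?hZ ?lZ ?h ?l.
by move: le' dw => /=; clear; lia.
Qed.

(** As long as the edges are too many to form a matching, each join removes three
of them, so that [2q-4] decreases along with [q]; as soon as they are few enough,
or [q] has become three, the sparse case takes over. *)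
Lemma local_win_dense q M B m cs : pos M m cs -> long cs -> size cs = q -> 4 <= q ->
  edges2 (adj B) [set x in all_ends m cs] <= (q.*2 - 4).*2 ->
  mwin board ham_path q M B.
Proof.
elim: q M B m cs => [|q IH] M B m cs ps big sz // q4 le.
move=> B' sB cB _; set Z := [set x in all_ends m cs] in le *.
have le' : edges2 (adj B') Z <= (q.+1.*2 - 3).*2.
  by apply: leq_trans (edges2_breaker Z sB cB) _; lia.
have [st _] := ps; have part := same_path_partner uS st big.
have cZ : #|Z| = q.+1.*2.+1 by rewrite (card_ends st big) sz.
have [le2|gt2] := leqP (edges2 (adj B') Z) q.+1.*2.
  have [|a [b [jab le3]]] := join_kills2 (@adj_sym _ B') (@adj_irr _ B') part cZ _ le2.
    by lia.
  have [e [m' [cs' [h1 h2 h3 h4 [h5 h6 h7]]]]] := join_move ps big jab.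
  exists e; split=> //; apply: (local_win h4) => //; last first.
    by apply: leq_trans h7 (leq_trans le3 _); clear; lia.
  by move: sz; rewrite h6 => -[].
have [a [b [jab le3]]] := join_kills3 (@adj_sym _ B') (@adj_irr _ B') part cZ q4 gt2 le'.
have [e [m' [cs' [h1 h2 h3 h4 [h5 h6 h7]]]]] := join_move ps big jab.
have sz' : size cs' = q by move: sz; rewrite h6 => -[].
exists e; split=> //; have [q3|q3] := ltnP q 4.
  by apply: (local_win h4) => //; apply: leq_trans h7 (leq_trans le3 _); move: q3; clear; lia.
apply: (IH _ _ m' cs') => //; apply: leq_trans h7 (leq_trans le3 _); clear; lia.
Qed.

Lemma cross_not_adj M m cs c d a b : pos M m cs -> c \in m :: cs -> d \in m :: cs ->
  a \in c -> b \in d -> c != d -> ~~ adj M a b.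
Proof.
move=> [st li] cL dL ac bd; apply: contraNN => /li[c' c'L /andP[ac' bc']].
have U := paths_flatten_uniq st; apply/eqP.
by rewrite (uniq_flatten_eq U cL c'L ac ac') (uniq_flatten_eq U dL c'L bd bc').
Qed.

Definition singles (ss : seq V) := [seq [:: x] | x <- ss].

(** Pairing up isolated vertices, Maker can always use an end of the edge that
Breaker has just claimed, so that no edge of his lies between two of them. *)
Lemma pick_singles B B' (ss : seq V) : uniq ss -> 2 < size ss ->
  B \subset B' -> #|B'| <= #|B|.+1 -> {in ss &, forall x y, ~~ adj B x y} ->
  exists a b ss', [/\ perm_eq ss [:: a, b & ss'], ~~ adj B' a b &
    {in ss' &, forall x y, ~~ adj B' x y}].
Proof.
move=> Us s3 sB cB nB.
have easy : {in ss &, forall x y, ~~ adj B' x y} ->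
    exists a b ss', [/\ perm_eq ss [:: a, b & ss'], ~~ adj B' a b &
    {in ss' &, forall x y, ~~ adj B' x y}].
  case: ss {Us nB} s3 => [|a [|b ss']] // _ h; exists a, b, ss'; split=> //.
    by apply: h; rewrite !in_cons eqxx ?orbT.
  by move=> x y xs ys; apply: h; rewrite !in_cons ?xs ?ys !orbT.
have [E|[x [y [xy E]]]] := breaker_move sB cB; first by apply: easy; rewrite E.
have [xs|xs] := boolP (x \in ss); last first.
  apply: easy => a b aS bS; rewrite E negb_or nB // andbT.
  apply/negP=> /orP[]/andP[/eqP ax /eqP bx]; subst; by rewrite ?aS ?bS in xs.
have p := perm_to_rem xs; have Ur := rem_uniq x Us.
have [b bR byn] : exists2 b, b \in rem x ss & b != y.
  have : 1 < size (rem x ss) by rewrite size_rem //; case: (size ss) s3.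
  case: (rem x ss) Ur => [|c [|d s]] //= /andP[cd _] _.
  have [cy|cy] := eqVneq c y; last by exists c; rewrite ?mem_head.
  exists d; first by rewrite !in_cons eqxx orbT.
  by rewrite -cy eq_sym; apply: contraNneq cd => ->; rewrite mem_head.
have bx : b != x by move: bR; rewrite mem_rem_uniq // !inE => /andP[].
have bS : b \in ss by apply: mem_rem bR.
exists x, b, (rem b (rem x ss)); split.
- by apply: perm_trans p _; rewrite perm_cons; apply: perm_to_rem.
- by rewrite E !negb_or !negb_and byn bx !orbT; apply: nB.
move=> c d /mem_rem; rewrite mem_rem_uniq // !inE => /andP[cx cS].
move=> /mem_rem; rewrite mem_rem_uniq // !inE => /andP[dx dS].
by rewrite E !negb_or !negb_and cx dx !orbT; apply: nB.
Qed.

Lemma paths_sub M m cs c x : paths M m cs -> c \in cs -> x \in c -> x \in u |: S.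
Proof.
move=> [_ _ _ /perm_mem p] cC xc; have := p x.
have xf : x \in flatten cs by apply/flattenP; exists c.
by rewrite mem_cat xf orbT !inE mem_enum => <-.
Qed.

(** The one vertex left over by the pairing is hung to the end of a pair: the at
most six Breaker edges at it cannot block all ten ends. *)
Lemma local_absorb M B ps s : pos M [:: u] ([:: s] :: ps) -> long ps -> size ps = 5 ->
  edges2 (adj B) (u |: S) <= 10 -> mwin board ham_path 6 M B.
Proof.
move=> [st li] big sz le B' sB cB _.
have le' : edges2 (adj B') (u |: S) <= 12.
  by apply: leq_trans (edges2_breaker _ sB cB) _; rewrite -[12]/(10 + 2) leq_add2r.
have sS : s \in u |: S by apply: (paths_sub st (mem_head _ _)); rewrite mem_head.
have dgs : dg (adj B') (u |: S) s <= 6.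
  by have := edges2D1 (@adj_sym _ B') (@adj_irr _ B') sS; move: le'; clear; lia.
pose F := flatten [seq ends c | c <- ps].
have FL b : b \in F -> exists2 c, c \in ps & b \in c.
  move=> /flatten_mapP[c cC bc]; exists c => //; apply: ends_sub bc.
  by have := allP big _ cC; case: (size c).
have [b bF nb] : exists2 b, b \in F & ~~ adj B' s b.
  apply/hasP/negPn/negP=> /hasPn H.
  have UF : uniq F.
    apply: flatten_ends_uniq => //; have := paths_flatten_uniq st.
    by rewrite /= => /and3P[].
  have : #|[set x in F]| <= 6.
    apply: leq_trans dgs; apply/subset_leq_card/subsetP=> x; rewrite inE => xF.
    rewrite inE; apply/andP; split; last by have := H x xF; rewrite negbK.
    by have [c cC xc] := FL x xF; apply: (paths_sub st _ xc); rewrite in_cons cC orbT.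
  rewrite cardsE (card_uniqP UF) size_flatten /shape -map_comp.
  by case: (ps) sz => [|? [|? [|? [|? [|? [|]]]]]].
have [c [ps' [Eb sc _ stc [_ co big' sz']]]] := pick_end [:: u] big bF.
have c0 : 0 < size c by apply: ltnW.
have ab : adj B' s b = false by apply/negbTE.
have sb : s != b.
  have := paths_flatten_uniq st; rewrite /= => /and3P[_ + _].
  apply: contraNneq => ->; have [d dC bd] := FL b bF; by apply/flattenP; exists d.
have [e Ee] := edgeP sb.
have [d dC bd] := FL b bF.
have bS : b \in u |: S by apply: (paths_sub st _ bd); rewrite in_cons dC orbT.
have co2 : coarser [:: [:: u], [:: s] & ps] [:: [:: u], s :: c & ps'].
  apply: coarser_cons.
  have co3 : coarser [:: [:: s], c & ps'] ((s :: c) :: ps').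
    apply: coarser_join => x; first by rewrite mem_seq1 => /eqP->; apply: mem_head.
    by move=> xc; rewrite in_cons xc orbT.
  exact: (coarser_trans (coarser_cons _ co) co3).
have st2 : paths (e |: M) [:: u] ((s :: c) :: ps').
  have sM : M \subset e |: M by apply: subsetUr.
  have := @paths_join (e |: M) [:: u] [:: s] c ps'; apply.
    exact: (stc _ [:: [:: s]] (pathsS sM st)).
  by rewrite Eb (adjU1 _ _ _ Ee) !eqxx.
have big2 : long ((s :: c) :: ps') by rewrite /long /= big' andbT ltnS.
exists e; split.
- exact: (edge_inside Ee).
- rewrite (adj_val _ Ee); apply: (@cross_not_adj M [:: u] ([:: s] :: ps) [:: s] d _ _ (conj st li)) => //.
  + by rewrite in_cons mem_head orbT.
  + by rewrite !in_cons dC !orbT.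
  + by rewrite mem_head.
  + by apply: contraTneq (allP big _ dC) => <-.
- by rewrite (adj_val _ Ee) ab.
apply: (@local_win_dense 5 _ _ [:: u] ((s :: c) :: ps')) => //.
- split.
    exact: st2.
  apply: (linked_setU1 Ee li co2); exists (s :: c); first by rewrite !in_cons eqxx orbT.
  by rewrite mem_head -Eb in_cons head_in ?orbT.
- by rewrite /= -sz'.
apply: leq_trans (edges2S _ _) le'; apply/subsetP=> x; rewrite inE.
exact: (all_ends_in st2).
Qed.

(** While single vertices are paired up, Breaker claims one edge for each new
pair, so that the number of his edges never exceeds that of the pairs. *)
Lemma local_opening j M B ps ss : pos M [:: u] (singles ss ++ ps) -> long ps ->
  size ss = j.*2.+1 -> size ps + j = 5 ->
  edges2 (adj B) (u |: S) <= (size ps).*2 -> {in ss &, forall x y, ~~ adj B x y} ->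
  mwin board ham_path (j + 6) M B.
Proof.
elim: j M B ps ss => [|j IH] M B ps ss ps0 big sz szp le nB.
  rewrite addn0 in szp; rewrite szp in le.
  by case: ss sz ps0 {nB} => [|s [|]] //= _ ps0; apply: (local_absorb ps0).
have [st li] := ps0; have U := paths_flatten_uniq st.
have Us : uniq ss.
  move: U; rewrite /= flatten_cat cat_uniq => /andP[_ /andP[+ _]].
  by rewrite (_ : flatten (singles ss) = ss) //; elim: (ss) => //= x s ->.
move=> B' sB cB _.
have [|a [b [ss' [p nab nB']]]] := pick_singles Us _ sB cB nB; first by rewrite sz.
have aS : a \in ss by rewrite (perm_mem p) mem_head.
have bS : b \in ss by rewrite (perm_mem p) !in_cons eqxx orbT.
have ab : a != b.
  by move: Us; rewrite (perm_uniq p) /= in_cons negb_or => /andP[/andP[]].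
have [e Ee] := edgeP ab.
have sub x : x \in ss -> [:: x] \in [:: u] :: singles ss ++ ps.
  by move=> xs; rewrite in_cons mem_cat map_f ?orbT.
have inS x : x \in ss -> x \in u |: S.
  by move=> xs; apply: (@paths_sub M [:: u] (singles ss ++ ps) [:: x]); rewrite ?mem_head // mem_cat map_f.
have q : perm_eq (singles ss ++ ps) [:: [:: a], [:: b] & singles ss' ++ ps].
  by rewrite -[X in perm_eq _ X]/(singles [:: a, b & ss'] ++ ps) perm_cat2r; apply: perm_map.
have q2 : perm_eq ([:: a; b] :: singles ss' ++ ps) (singles ss' ++ [:: a; b] :: ps).
  by rewrite perm_sym -cat1s perm_catCA.
exists e; split.
- by apply: (edge_inside Ee); apply: inS.
- rewrite (adj_val _ Ee); apply: (cross_not_adj ps0 (sub a aS) (sub b bS)); rewrite ?mem_head //.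
  by apply: contraNneq ab => -[->].
- by rewrite (adj_val _ Ee).
apply: (IH _ _ ([:: a; b] :: ps) ss') => //.
- split.
    apply: (paths_perm q2).
    have := @paths_join (e |: M) [:: u] [:: a] [:: b] (singles ss' ++ ps); apply.
      by apply: (paths_perm q); apply: pathsS st; apply: subsetUr.
    by rewrite (adjU1 _ _ _ Ee) !eqxx.
  apply: (linked_setU1 Ee li).
    apply: coarser_cons => c; rewrite (perm_mem q) => cC.
    have [] := @coarser_join [:: a] [:: b] [:: a; b] (singles ss' ++ ps) _ _ c cC.
    + by move=> x; rewrite !inE => ->.
    + by move=> x; rewrite !inE => ->; rewrite orbT.
    by move=> d; rewrite (perm_mem q2); exists d.
  exists [:: a; b]; rewrite ?mem_head ?in_cons ?eqxx ?orbT //.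
  by rewrite mem_cat in_cons eqxx !orbT.
- by have := perm_size p; rewrite sz /= doubleS => -[].
- by rewrite /= addSn -addnS.
- apply: leq_trans (edges2_breaker _ sB cB) _.
  by rewrite /= doubleS addn2 !ltnS.
Qed.

(** Eleven vertices give five pairs and a last vertex; once this is absorbed there
are [q = 5] paths and at most [6 = 2q-4] Breaker edges, which is just what the
dense case allows. *)
Lemma local_game B : #|S| = 11 ->
  {in u |: S &, forall x y, ~~ adj B x y} -> mwin board ham_path 11 set0 B.
Proof.
move=> cS nB; apply: (@local_opening 5 _ _ [::] (enum S)) => //.
- rewrite cats0; split; last first.
    by move=> a b /adjP[e]; rewrite inE.
  have E : flatten (singles (enum S)) = enum S by elim: (enum S) => //= x s ->.
  split.
  + by exists [::].
  + by apply/allP=> c /mapP[x _ ->].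
  + by apply/allP=> c; rewrite in_cons => /orP[/eqP->|/mapP[x _ ->]].
  + by rewrite E.
- by rewrite -cardE cS.
- rewrite /edges2 big1 // => a aS; apply/eqP; rewrite cards_eq0; apply/eqP/setP=> b.
  rewrite in_set [RHS]in_set0; case bS: (b \in _) => //=.
  exact/negbTE/nB.
by move=> x y; rewrite !mem_enum => xS yS; apply: nB; rewrite !inE ?xS ?yS orbT.
Qed.

End Local.

(** * Pendant paths *)

Section Pendant.
Variables (V : finType) (f : V -> V).

(** In the tree with parent function [f], the vertices [l], [f l], up to the
[L]-th one form a path that starts at the leaf [l] and to which nothing else is
attached: the only child of each is its predecessor. *)
Definition pendant L l :=
  [forall i : 'I_L, forall y, (f y == iter i f l) ==> (0 < i) && (y == iter i.-1 f l)].

Lemma pendantP L l : reflect (forall i y, i < L -> f y = iter i f l ->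
  0 < i /\ y = iter i.-1 f l) (pendant L l).
Proof.
apply: (iffP forallP) => [H i y iL /eqP E|H i].
  have /forallP/(_ y)/implyP/(_ E) := H (Ordinal iL).
  by case/andP=> i0 /eqP.
apply/forallP=> y; apply/implyP=> /eqP E.
by have [-> ->] := H i y (ltn_ord i) E; rewrite eqxx.
Qed.

Lemma pendant_inj L l l' i j : pendant L l -> pendant L l' -> i < L -> j < L ->
  iter i f l = iter j f l' -> l = l' /\ i = j.
Proof.
move=> /pendantP p /pendantP p'; elim: i j => [|i IH] [|j] iL jL //.
- by move=> /= E; have [] := p 0 (iter j f l') iL (esym E).
- by move=> /= E; have [] := p' 0 (iter i f l) jL E.
rewrite [RHS]iterS => /esym/(p i.+1 _ iL)[_ /esym E].
by have [|||-> ->] := IH j; rewrite // ltnW.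
Qed.

Lemma pendant_root L l i r : f r = r -> pendant L l -> i < L -> iter i f l != r.
Proof.
move=> fr /pendantP p; elim: i => [|i IH] iL; apply/eqP=> E.
  by have [] := p 0 r iL; rewrite // fr E.
have [_ E'] : 0 < i.+1 /\ r = iter i f l by apply: (p i.+1 r iL); rewrite fr E.
by have := IH (ltnW iL); rewrite -E' eqxx.
Qed.

End Pendant.

Lemma card_bigcup_le (T I : finType) (P : pred I) (F : I -> {set T}) :
  #|\bigcup_(i | P i) F i| <= \sum_(i | P i) #|F i|.
Proof.
elim/big_rec2: _ => [|i m A _ le]; first by rewrite cards0.
by apply: leq_trans (leq_card_setU _ _) _; rewrite leq_add2l.
Qed.

Lemma card_bigcup_const (T I : finType) (A : {set I}) (F : I -> {set T}) c :
  (forall i, i \in A -> #|F i| <= c) -> #|\bigcup_(i in A) F i| <= #|A| * c.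
Proof.
move=> le; apply: leq_trans (card_bigcup_le _ _) _.
by rewrite -sum_nat_const; apply: leq_sum.
Qed.

(** * The end of the game: all remaining vertices lie on pendant paths *)

Section Endgame.
Variables (n : nat) (r : 'I_n) (f : 'I_n -> 'I_n) (D Gs : {set 'I_n}).
Local Notation V := 'I_n.
Implicit Types (M B : {set edge n}) (phi : {perm 'I_n}).
Hypothesis Gs_pend : forall l, l \in Gs -> pendant f 12 l.
Hypothesis Gs_top : forall l, l \in Gs -> iter 11 f l \in D.
Hypothesis Gs_out : forall l i, l \in Gs -> i < 11 -> iter i f l \notin D.
Hypothesis out_Gs : forall x, x \notin D ->
  exists p : V * nat, [/\ p.1 \in Gs, p.2 < 11 & x = iter p.2 f p.1].

(** Maker's graph contains the tree whose edges join each vertex other than the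
root [r] to its parent. *)
Definition embedded M := exists phi : {perm 'I_n},
  forall x, x != r -> adj M (phi x) (phi (f x)).

Definition chain l : {set V} := [set iter i f l | i : 'I_12].

Lemma chainP l x : reflect (exists2 i, i < 12 & x = iter i f l) (x \in chain l).
Proof.
apply: (iffP imsetP) => [[i _ ->]|[i iL ->]]; first by exists (i : nat).
by exists (Ordinal iL).
Qed.

Lemma card_chain l : #|chain l| <= 12.
Proof. by apply: leq_trans (leq_imset_card _ _) _; rewrite card_ord. Qed.

Lemma chain_eq l l' x : l \in Gs -> l' \in Gs -> x \in chain l -> x \in chain l' -> l = l'.
Proof.
move=> lG l'G /chainP[i iL ->] /chainP[j jL E].
by have [] := pendant_inj (Gs_pend lG) (Gs_pend l'G) iL jL E.
Qed.

Lemma chain_D l x : l \in Gs -> x \in chain l -> x \in D -> x = iter 11 f l.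
Proof.
move=> lG /chainP[i iL ->] xD; suff -> : i = 11 by [].
by apply/eqP; rewrite eqn_leq -ltnS iL leqNgt; apply: contraL xD; apply: Gs_out.
Qed.

Section Clean.
Variables (B : {set edge n}) (K : nat) (phi : {perm 'I_n}).
Hypothesis degK : forall x, x \notin D \/ (exists2 l, l \in Gs & x \in chain l) ->
  dg (adj B) setT (phi x) <= K.
Hypothesis KGs : K * 24 + 12 < #|~: D|.

Definition grouped a b := [exists l in Gs, (a \in chain l) && (b \in chain l)].

Definition bad (psi : {perm 'I_n}) : {set V * V} :=
  [set p | grouped p.1 p.2 && adj B (psi p.1) (psi p.2)].

Lemma grouped_sym a b : grouped a b = grouped b a.
Proof. by apply: eq_existsb => l; rewrite andbCA andbC -andbA andbC; case: (_ \in Gs); rewrite //= andbC. Qed.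

(** An assignment with the fewest Breaker edges inside the groups has none:
otherwise one vertex of such an edge could be swapped with a vertex of another
group such that neither has a Breaker neighbour among its new companions.  The
degree bound [K] excludes at most [24 K + 12] vertices. *)
Lemma clean_assignment : exists psi : {perm 'I_n},
  (forall x, x \in D -> psi x = phi x) /\
  forall l, l \in Gs -> {in chain l &, forall x y, ~~ adj B (psi x) (psi y)}.
Proof.
pose P (s : {perm 'I_n}) := [forall x in D, s x == phi x].
have Pphi : P phi by apply/forall_inP.
case: (@arg_minnP _ phi P (fun s => #|bad s|) Pphi) => psi /forall_inP Ppsi min.
have {}Ppsi x : x \in D -> psi x = phi x by move=> /Ppsi/eqP.
have deg a l : l \in Gs -> a \in chain l -> dg (adj B) setT (psi a) <= K.
  move=> lG al; have [aD|aD] := boolP (a \in D).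
    by rewrite Ppsi //; apply: degK; right; exists l.
  rewrite -[psi a](permKV phi); apply: degK; left.
  apply: contraNN aD => dD.
  have := Ppsi _ dD; rewrite permKV => /perm_inj E; by rewrite -E.
exists psi; split=> // l lG x y xl yl; apply/negP=> axy.
wlog xD : x y xl yl axy / x \notin D.
  move=> H; have [xD|] := boolP (x \in D); last exact: H axy.
  apply: (H y x) => //; first by rewrite adj_sym.
  apply/negP=> yD; have := adj_neq axy.
  by rewrite (chain_D lG xl xD) (chain_D lG yl yD) eqxx.
have gx b : grouped x b = (b \in chain l).
  apply/existsP/idP => [[l' /and3P[l'G xl' bl']]|bl]; last by exists l; rewrite lG xl.
  by rewrite (chain_eq lG l'G xl xl').
pose nb v := [set b | adj B v (psi b)].
have nbK a l' : l' \in Gs -> a \in chain l' -> #|nb (psi a)| <= K.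
  move=> l'G al; apply: leq_trans (deg a l' l'G al).
  rewrite -(card_imset _ (@perm_inj _ psi)); apply/subset_leq_card/subsetP=> v.
  by case/imsetP=> b; rewrite !inE => ab ->.
(* E2 spoils the old group of x, E3 the group into which x would move *)
pose E2 := \bigcup_(b in chain l) nb (psi b).
pose E3 := \bigcup_(b in nb (psi x)) [set z | grouped z b].
have cE2 : #|E2| <= 12 * K.
  apply: leq_trans (card_bigcup_const (c := K) _) _; first by move=> b; apply: nbK.
  by rewrite leq_mul2r card_chain orbT.
have cE3 : #|E3| <= K * 12.
  apply: leq_trans (card_bigcup_const (c := 12) _) _; last first.
    by rewrite leq_mul2r (nbK _ l).
  move=> b _; have [->|[z]] := set_0Vmem [set z | grouped z b]; first by rewrite cards0.
  rewrite inE => /existsP[l' /and3P[l'G _ bl']].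
  apply: leq_trans (card_chain l'); apply/subset_leq_card/subsetP=> w.
  rewrite inE => /existsP[l'' /and3P[l''G wl bl]].
  by rewrite (chain_eq l'G l''G bl' bl).
have [z zD] : exists2 z, z \notin D & z \notin chain l :|: E2 :|: E3.
  have [/subsetP sub|/subsetPn[z]] := boolP (~: D \subset chain l :|: E2 :|: E3); last first.
    by rewrite inE => zD zE; exists z.
  have := subset_leq_card (introT subsetP sub).
  rewrite leqNgt; suff -> : #|chain l :|: E2 :|: E3| < #|~: D| by [].
  apply: leq_ltn_trans (leq_card_setU _ _) _.
  apply: leq_ltn_trans (leq_add (leq_card_setU _ _) (leqnn _)) _.
  move: (card_chain l) cE2 cE3 KGs; clear; lia.
rewrite !inE !negb_or => /andP[/andP[zl /bigcupP zE2] /bigcupP zE3].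
have {}zE2 b : b \in chain l -> adj B (psi b) (psi z) = false.
  by move=> bl; apply/negbTE/negP=> h; apply: zE2; exists b; rewrite ?inE.
have {}zE3 b : grouped z b -> adj B (psi x) (psi b) = false.
  by move=> bl; apply/negbTE/negP=> h; apply: zE3; exists b; rewrite ?inE.
pose chi : {perm 'I_n} := (tperm x z * psi)%g.
have chiE a : chi a = psi (tperm x z a) by rewrite permM.
have Pchi : P chi.
  apply/forall_inP=> a aD; rewrite chiE tpermD ?Ppsi //.
    by apply: contraNneq xD => ->.
  by apply: contraNneq zD => ->.
have := min chi Pchi; rewrite leqNgt; case/negP; apply: proper_card.
have xz : x != z by apply: contraNneq zl => <-.
have bx b : grouped x b -> adj B (chi x) (chi b) = false.
  rewrite !chiE tpermL => gb.
  have [->|bx] := eqVneq b x; first by rewrite tpermL adj_irr.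
  rewrite tpermD ?[x == b]eq_sym //; last by apply: contraNneq zl => ->; rewrite -gx.
  by rewrite adj_sym zE2 // -gx.
have bz b : grouped z b -> adj B (chi z) (chi b) = false.
  rewrite !chiE tpermR => gb.
  have [->|bz] := eqVneq b z; first by rewrite tpermR adj_irr.
  rewrite tpermD ?[z == b]eq_sym //; last first.
    by apply: contraNneq zl => E; rewrite -gx grouped_sym E.
  exact: zE3.
apply/properP; split.
  apply/subsetP=> -[a b]; rewrite !inE /= => /andP[gab]; rewrite gab /=.
  have [E|ax] := eqVneq a x; first by subst a; rewrite bx.
  have [E|az] := eqVneq a z; first by subst a; rewrite bz.
  have [E|xb] := eqVneq b x; first by subst b; rewrite adj_sym bx // grouped_sym.
  have [E|zb] := eqVneq b z; first by subst b; rewrite adj_sym bz // grouped_sym.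
  by rewrite !chiE !tpermD // eq_sym.
exists (x, y); first by rewrite inE /= gx yl.
by rewrite inE /= gx yl bx // gx.
Qed.

End Clean.
Section Finish.
Variables (M B : {set edge n}) (phi : {perm 'I_n}).
Hypothesis M_in : forall a b, adj M a b -> a \in phi @: D.
Hypothesis M_emb : forall x, x \in D -> x != r -> adj M (phi x) (phi (f x)).
Hypothesis D_closed : forall x, x \in D -> f x \in D.
Hypothesis clean : forall l, l \in Gs ->
  {in chain l &, forall x y, ~~ adj B (phi x) (phi y)}.

(** The top vertex of a pendant path is already embedded when the endgame starts;
the eleven vertices below it are still free. *)
Definition base l := phi (iter 11 f l).
Definition rest l : {set V} := [set phi (iter i f l) | i : 'I_11].
Definition group_board l := if l \in Gs then inside (base l |: rest l) else set0.

Lemma restP l v : reflect (exists2 i, i < 11 & v = phi (iter i f l)) (v \in rest l).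
Proof.
apply: (iffP imsetP) => [[i _ ->]|[i iL ->]]; first by exists (i : nat).
by exists (Ordinal iL).
Qed.

Lemma rest_chain l v : v \in base l |: rest l -> exists2 x, x \in chain l & v = phi x.
Proof.
case/setU1P=> [->|/restP[i iL ->]].
  by exists (iter 11 f l) => //; apply/chainP; exists 11.
by exists (iter i f l) => //; apply/chainP; exists i => //; apply: ltnW.
Qed.

Lemma rest_out l v : l \in Gs -> v \in rest l -> v \notin phi @: D.
Proof. by move=> lG /restP[i iL ->]; rewrite (mem_imset _ _ (@perm_inj _ phi)) Gs_out. Qed.

Lemma base_in l : l \in Gs -> base l \in phi @: D.
Proof. by move=> lG; apply: imset_f; apply: Gs_top. Qed.

Lemma group_board_disj l l' : l != l' -> [disjoint group_board l & group_board l'].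
Proof.
move=> ll; apply/pred0P=> e /=; apply/negP; rewrite /group_board.
case: ifP => lG; last by rewrite inE.
case: ifP => l'G; last by rewrite !inE andbF.
rewrite !inE => /andP[/subsetP s /subsetP s'].
have [x [y [_ E]]] := edge_ends e.
have xe : x \in val e by rewrite E !inE eqxx.
have [a al Ea] := rest_chain (s x xe); have [b bl Eb] := rest_chain (s' x xe).
have ab : a = b by apply: (@perm_inj _ phi); rewrite -Ea -Eb.
by subst b; rewrite (chain_eq lG l'G al bl) eqxx in ll.
Qed.

Lemma card_rest l : l \in Gs -> #|rest l| = 11.
Proof.
move=> lG; rewrite card_imset ?card_ord // => i j /perm_inj E.
have pl := Gs_pend lG; have [||_ ij] := pendant_inj pl pl _ _ E.
- exact/leqW/ltn_ord.
- exact/leqW/ltn_ord.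
exact: val_inj.
Qed.

Lemma group_win l :
  mwin (group_board l) (fun M' => l \in Gs -> ham_path (base l) (rest l) M')
    (if l \in Gs then 11 else 0) (M :&: group_board l) (B :&: group_board l).
Proof.
rewrite /group_board; case: ifP => lG //.
have bR : base l \notin rest l by apply: contraL (base_in lG); apply: rest_out.
have -> : M :&: inside (base l |: rest l) = set0.
  apply/setP=> e; rewrite !inE; apply/negP=> /andP[eM /subsetP s].
  have [x [y [xy E]]] := edge_ends e; have a : adj M x y by rewrite -(adj_val _ E).
  have inb z : z \in val e -> z \in phi @: D -> z = base l.
    by move=> /s/setU1P[//|/(rest_out lG)/negbTE->].
  have ex : x = base l by apply: inb (M_in a); rewrite E !inE eqxx.
  have ey : y = base l.
    by apply: inb; [rewrite E !inE eqxx orbT | apply: (@M_in y x); rewrite adj_sym].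
  by rewrite ex ey eqxx in xy.
apply: mwin_impl (local_game bR (card_rest lG) _) => // x y xl yl.
have [a al ->] := rest_chain xl; have [b bl ->] := rest_chain yl.
by apply: contraNN (clean lG al bl); apply: adjS; apply: subsetIl.
Qed.

(** The Hamilton paths found on the single boards replace the assignment outside
[D]: the vertex at depth [i] above the leaf goes to the place [10 - i] of its
path. *)
Lemma assemble M' : M \subset M' ->
  (forall l, l \in Gs -> ham_path (base l) (rest l) (M' :&: group_board l)) ->
  embedded M'.
Proof.
move=> sM ham.
have /boolp.choice[s Hs] : forall l, exists s : seq V, l \in Gs ->
    perm_eq s (enum (rest l)) /\ path (adj M') (base l) s.
  move=> l; have [lG|lG] := boolP (l \in Gs); last by exists [::].
  have [s [p q]] := ham l lG; exists s => _; split=> //.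
  by apply: sub_path q => x y; apply: adjS; apply: subsetIl.
have /boolp.choice[w Hw] : forall x, exists p : V * nat, x \notin D ->
    [/\ p.1 \in Gs, p.2 < 11 & x = iter p.2 f p.1].
  move=> x; have [xD|/out_Gs[p Hp]] := boolP (x \in D); first by exists (x, 0).
  by exists p.
have w_eq l i : l \in Gs -> i < 11 -> w (iter i f l) = (l, i).
  move=> lG iL; have [l'G i'L E] := Hw _ (Gs_out lG iL).
  have [||] := pendant_inj (Gs_pend lG) (Gs_pend l'G) _ _ E; try exact: leqW.
  by case: (w _) => a b /= -> ->.
pose psi x := if x \in D then phi x else nth x (s (w x).1) (10 - (w x).2).
have sz l : l \in Gs -> size (s l) = 11.
  by move=> lG; have [p _] := Hs l lG; rewrite (perm_size p) -cardE card_rest.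
have psi_rest x : x \notin D -> psi x \in rest (w x).1.
  move=> xD; rewrite /psi (negbTE xD); have [lG iL _] := Hw x xD.
  have [p _] := Hs _ lG; rewrite -mem_enum -(perm_mem p) mem_nth // sz //.
  by rewrite ltnS leq_subr.
have psi_inj : injective psi.
  have cross x y : x \in D -> y \notin D -> psi x = psi y -> False.
    move=> xD yD E; have := psi_rest y yD; have [lG _ _] := Hw y yD.
    by move=> /(rest_out lG); rewrite -E /psi xD imset_f.
  move=> x y E; have [xD|xD] := boolP (x \in D); have [yD|yD] := boolP (y \in D).
  - by move: E; rewrite /psi xD yD => /perm_inj.
  - by case: (cross x y).
  - by case: (cross y x).
  have rx := psi_rest x xD; have ry := psi_rest y yD; rewrite -E in ry.
  have [lG iL Ex] := Hw x xD; have [l'G i'L Ey] := Hw y yD.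
  have [a al Ea] := rest_chain (setU1r _ rx); have [b bl Eb] := rest_chain (setU1r _ ry).
  have ab : a = b by apply: (@perm_inj _ phi); rewrite -Ea -Eb.
  subst b; have ll := chain_eq lG l'G al bl; have [p _] := Hs _ lG.
  move: E; rewrite /psi (negbTE xD) (negbTE yD) -ll (set_nth_default x y); last first.
    by rewrite sz // ltnS leq_subr.
  move/eqP; rewrite nth_uniq ?sz ?ltnS ?leq_subr ?(perm_uniq p) ?enum_uniq // => /eqP E.
  rewrite Ex Ey -ll; congr (iter _ _ _); move: E iL i'L; clear; lia.
exists (perm psi_inj) => x xr; rewrite !permE.
have [xD|xD] := boolP (x \in D).
  by rewrite /psi xD D_closed //; apply: adjS sM _; apply: M_emb.
have [lG iL Ex] := Hw x xD; set l := (w x).1 in lG Ex *; set i := (w x).2 in iL Ex *.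
have [_ /(pathP x) pt] := Hs l lG.
have fx : f x = iter i.+1 f l by rewrite Ex.
rewrite adj_sym; have [i10|i10] := ltnP i 10.
  rewrite {1}/psi fx (negbTE (Gs_out lG _)) // w_eq //= /psi (negbTE xD) -/l -/i.
  have -> : 10 - i = (10 - i.+1).+1 by move: i10; clear; lia.
  have lt : (10 - i.+1).+1 < size (s l) by rewrite sz // !ltnS; move: i10; clear; lia.
  rewrite (set_nth_default x) ?(ltnW lt) //.
  exact: (pt _ lt).
have {i10}i10 : i = 10 by move: iL i10; clear; lia.
rewrite {1}/psi fx i10 Gs_top // /psi (negbTE xD) -/l -/i i10 subnn.
by apply: (pt 0); rewrite sz.
Qed.

(** The groups are disjoint, hence so are their boards, and each needs eleven
moves. *)
Lemma endgame_win : mwin setT embedded (#|Gs| * 11) M B.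
Proof.
have := mwin_family (M := M) (B := B) (@group_board_disj) group_win.
have -> : \sum_l (if l \in Gs then 11 else 0) = #|Gs| * 11.
  by rewrite -big_mkcond sum_nat_const.
by apply: mwin_impl => M' sM H; apply: assemble.
Qed.

End Finish.
End Endgame.

(** * Embedding the core *)

Section Core.
Variables (n : nat) (r : 'I_n) (f : 'I_n -> 'I_n).
Local Notation V := 'I_n.
Implicit Types (M B : {set edge n}) (phi : {perm 'I_n}) (D : {set V}).
Hypothesis fr : f r = r.
Hypothesis reach : forall x, exists i, iter i f x = r.

Definition closed_set D := r \in D /\ forall x, x \in D -> f x \in D.

Definition intact D := [set l | pendant f 12 l & iter 10 f l \notin D].

Definition unfinished D := [set x | (x \notin D) || [exists y, (f y == x) && (y \notin D)]].

Definition kids D x := #|[set y in D | f y == x]|.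

Definition deg B v := dg (adj B) setT v.

Variable th : nat.

(** The number of moves spent on dangerous vertices, those of Breaker degree above
[th]: three to embed one, and one for each of its children.  During these moves
the other degrees may grow and pendant paths may be used up. *)
Definition waste D phi B :=
  \sum_(x in D | th < deg B (phi x)) (3 + kids D x).

Lemma closed_iter D x i j : closed_set D -> i <= j -> iter i f x \in D -> iter j f x \in D.
Proof.
move=> [_ cl] /subnK<- xD; elim: (j - i) => //= m; exact: cl.
Qed.

Lemma card_intact D : closed_set D -> #|intact D| * 11 <= #|~: D|.
Proof.
move=> cl; pose h (p : V * 'I_11) := iter p.2 f p.1.
have <- : #|setX (intact D) [set: 'I_11]| = #|intact D| * 11.
  by rewrite cardsX cardsT card_ord.
have hi : {in setX (intact D) [set: 'I_11] &, injective h}.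
  move=> [l i] [l' j]; rewrite !inE /= => /andP[/andP[p _] _] /andP[/andP[p' _] _].
  rewrite /h /= => E; have [<- ij] := pendant_inj p p' (leqW (ltn_ord i)) (leqW (ltn_ord j)) E.
  by congr (_, _); apply: val_inj.
rewrite -(card_in_imset hi); apply/subset_leq_card/subsetP=> x /imsetP[[l i]].
rewrite !inE /= andbT => /andP[_ out] ->; apply: contraNN out => xD.
by apply: (@closed_iter D l i 10 cl _ xD); rewrite -ltnS.
Qed.

Lemma deg_mono B B' v : B \subset B' -> deg B v <= deg B' v.
Proof. by move=> s; apply: dgS => // b; apply: adjS. Qed.

Lemma deg_move B B' v : B \subset B' -> #|B'| <= #|B|.+1 -> deg B' v <= (deg B v).+1.
Proof.
move=> sB cB; have [->|[x [y [xy E]]]] := breaker_move sB cB; first exact: leqW.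
rewrite /deg /dg -addn1 -(cards1 (if v == x then y else x)).
apply: leq_trans (leq_card_setU _ _); apply/subset_leq_card/subsetP=> b.
rewrite !inE E /=; case: (eqVneq v x) => [->|vx] /=.
  by rewrite (negbTE xy) /= orbF; case/orP=> ->; rewrite ?orbT.
by case/orP=> [/andP[_ ->]|->]; rewrite ?orbT.
Qed.

Lemma sum_deg B : \sum_v deg B v <= #|B|.*2.
Proof.
have -> : \sum_v deg B v = edges2 (adj B) setT.
  by apply: eq_bigl => v; rewrite inE.
move Em: #|B| => m; elim: m B Em => [|m IH] B Em.
  rewrite (cards0_eq Em) /edges2 big1 // => v _; rewrite dgE big1 // => b _.
  by apply/eqP; rewrite eqb0; apply/negP=> /adjP[e]; rewrite inE.
have [B0|[e eB]] := set_0Vmem B; first by rewrite B0 cards0 in Em.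
have cB : #|B :\ e| = m by move: Em; rewrite (cardsD1 e) eB => -[].
have := @edges2_breaker n (B :\ e) B setT (subsetDl _ _); rewrite cB Em leqnn => /(_ isT) H.
apply: leq_trans H _; rewrite doubleS addn2 !ltnS; exact: (IH _ cB).
Qed.

Lemma waste_mono D phi B B' : B \subset B' -> waste D phi B <= waste D phi B'.
Proof.
move=> sB; rewrite /waste [X in X <= _]big_mkcondr [X in _ <= X]big_mkcondr /=.
apply: leq_sum => x _; case: ltnP => // h; rewrite (leq_trans h) //.
exact: deg_mono.
Qed.

Variable Dl : nat.
Hypothesis degD : forall x, #|[set y | f y == x]| <= Dl.

(** Few vertices can be dangerous, and each costs at most [3 + Dl] moves. *)
Lemma waste_bound D phi B : waste D phi B * th <= #|B|.*2 * (3 + Dl).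
Proof.
apply: leq_trans (leq_mul (sum_deg B) (leqnn _)).
rewrite (reindex_inj (@perm_inj _ phi)) /= big_distrl /= /waste big_distrl /=.
rewrite big_mkcond /=; apply: leq_sum => x _; case: ifP => // /andP[_ h].
rewrite mulnC; apply: leq_mul; first exact: ltnW.
rewrite leq_add2l; apply: leq_trans (degD x).
by apply/subset_leq_card/subsetP=> y; rewrite !inE => /andP[].
Qed.

(** ** Extending the embedding by one vertex *)

Section Embed.
Variables (D : {set V}) (phi : {perm 'I_n}) (c y : V).
Hypothesis clD : closed_set D.
Hypothesis cD : c \notin D.
Hypothesis fcD : f c \in D.
Hypothesis yD : y \notin phi @: D.

Definition emb : {perm 'I_n} := (phi * tperm (phi c) y)%g.

Lemma embE : emb c = y.
Proof. by rewrite permM tpermL. Qed.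

Lemma emb_D x : x \in D -> emb x = phi x.
Proof.
move=> xD; rewrite permM tpermD //.
  by apply: contraNneq cD => /perm_inj->.
by apply: contraNneq yD => ->; apply: imset_f.
Qed.

Lemma emb_image : emb @: (c |: D) = y |: phi @: D.
Proof.
rewrite imsetU1 embE; congr (_ |: _); apply: eq_in_imset => x; exact: emb_D.
Qed.

Lemma emb_closed : closed_set (c |: D).
Proof.
have [rD cl] := clD; split; first by rewrite inE rD orbT.
by move=> x /setU1P[->|/cl h]; rewrite inE ?fcD ?h orbT.
Qed.

(** No vertex becomes unfinished, so degree bounds are inherited. *)
Lemma emb_unfinished : emb @: unfinished (c |: D) \subset phi @: unfinished D.
Proof.
apply/subsetP=> v /imsetP[x]; rewrite inE => h ->.
have [xD|xD] := boolP (x \in D).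
  rewrite emb_D //; apply: imset_f; rewrite inE xD /=.
  move: h; rewrite inE xD orbT /= => /existsP[z /andP[fz]].
  by rewrite !inE negb_or => /andP[_ zD]; apply/existsP; exists z; rewrite fz.
rewrite -[emb x](permKV phi); apply: imset_f; rewrite inE.
apply/orP; left; apply: contraNN xD => dD.
have := emb_D dD; rewrite permKV => /perm_inj E; by rewrite -E.
Qed.

(** A move on behalf of a dangerous vertex increases the waste at least as much as
Breaker's answer increases the degrees. *)
Lemma emb_waste B : waste D phi B + (th < deg B (phi (f c))) + 3 * (th < deg B y)
  <= waste (c |: D) emb B.
Proof.
rewrite /waste !big_mkcondr /= [X in _ <= X](big_setU1) //= embE addnC.
apply: leq_add; first by case: ltnP => // _; rewrite muln1 leq_addr.
rewrite (bigD1 (f c)) //= [X in _ <= X](bigD1 (f c)) //= addnAC.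
apply: leq_add.
  rewrite emb_D //; case: ltnP => // _; rewrite -addnA leq_add2l addn1.
  rewrite /kids; apply: (@leq_trans #|c |: [set z in D | f z == f c]|).
    by rewrite cardsU1 !inE negb_and cD.
  apply/subset_leq_card/subsetP=> z; rewrite !inE.
  by case/orP=> [/eqP->|/andP[-> ->]]; rewrite ?eqxx // orbT.
apply: leq_sum => x /andP[xD _]; rewrite emb_D //; case: ifP => // _.
rewrite leq_add2l; apply/subset_leq_card/subsetP=> z; rewrite !inE.
by case/andP=> -> ->; rewrite orbT.
Qed.

Lemma emb_intact : #|intact D| <= #|intact (c |: D)|.+1.
Proof.
apply: (@leq_trans #|intact (c |: D) :|: [set l | pendant f 12 l & iter 10 f l == c]|).
  apply/subset_leq_card/subsetP=> l; rewrite !inE => /andP[-> h] /=.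
  by rewrite negb_or h andbT; case: eqP.
apply: leq_trans (leq_card_setU _ _) _; rewrite -[X in _ <= X]addn1 leq_add2l.
apply/card_le1_eqP=> l l'; rewrite !inE => /andP[p /eqP E] /andP[p' /eqP E'].
by have [] := @pendant_inj _ f 12 l l' 10 10 p p' isT isT (etrans E (esym E')).
Qed.

Lemma emb_intact_core : (forall l, pendant f 12 l -> iter 10 f l != c) ->
  #|intact D| <= #|intact (c |: D)|.
Proof.
move=> core; apply/subset_leq_card/subsetP=> l; rewrite !inE => /andP[p h].
by rewrite p negb_or h core.
Qed.

Lemma emb_adj M M' : (forall x, x \in D -> x != r -> adj M (phi x) (phi (f x))) ->
  M \subset M' -> adj M' (phi (f c)) y ->
  forall x, x \in c |: D -> x != r -> adj M' (emb x) (emb (f x)).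
Proof.
move=> Me sM a x /setU1P[->|xD] xr; first by rewrite embE emb_D // adj_sym.
by have [_ cl] := clD; rewrite !emb_D ?cl //; apply: adjS sM _; apply: Me.
Qed.

End Embed.

Lemma pick_free D phi B K (vs L : seq V) :
  (forall v, v \in vs -> deg B v <= K) -> size vs * K + size L < #|~: D| ->
  exists y, [/\ y \notin phi @: D, y \notin L & forall v, v \in vs -> ~~ adj B v y].
Proof.
move=> dK lt.
pose N := \bigcup_(v in [set v in vs]) [set b in setT | adj B v b].
have cN : #|N| <= size vs * K.
  apply: leq_trans (card_bigcup_const (c := K) _) _.
    by move=> v; rewrite inE; apply: dK.
  by rewrite leq_mul2r cardsE card_size orbT.
have [/subsetP sub|/subsetPn[y]] := boolP (~: (phi @: D) \subset N :|: [set y in L]).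
  have := subset_leq_card (introT subsetP sub).
  have -> : #|~: (phi @: D)| = #|~: D|.
    have := cardsC D; rewrite -(cardsC (phi @: D)) card_imset; last exact: perm_inj.
    by move/addnI.
  rewrite leqNgt; case/negP; apply: leq_ltn_trans (leq_card_setU _ _) _.
  by apply: leq_ltn_trans lt; rewrite leq_add // cardsE card_size.
rewrite !inE negb_or => yD /andP[yN yL]; exists y; split=> // v vL.
by apply: contraNN yN => a; apply/bigcupP; exists v; rewrite !inE.
Qed.

(** ** Maker's strategy for the core *)

Variables (N0 Wm : nat).
(* At most [2n/th] vertices become dangerous, so that the waste never exceeds [Wm];
   after subtracting it from the number [N0] of pendant paths, the paths left
   must offer free vertices enough for all choices to be made. *)
Hypothesis th_gt0 : 0 < th.
Hypothesis hW : n.*2 * (3 + Dl) <= Wm * th.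
Hypothesis hN : Wm * 11 + (th + Wm + 3) * 24 + 100 <= N0 * 11.

Lemma waste_le D phi B : #|B| <= n -> waste D phi B <= Wm.
Proof.
move=> le; rewrite -(leq_pmul2r th_gt0); apply: leq_trans hW.
apply: leq_trans (waste_bound D phi B) _.
by rewrite leq_mul2r leq_double le orbT.
Qed.

Definition in_core D M phi := (forall a b, adj M a b -> a \in phi @: D) /\
  forall x, x \in D -> x != r -> adj M (phi x) (phi (f x)).

(** The invariant: growing degrees and lost pendant paths are both paid for by
the waste. *)
Definition core_inv D phi M B k :=
  [/\ closed_set D, #|D| + k = n, #|B| + k <= n, in_core D M phi &
  (forall v, v \in phi @: unfinished D -> deg B v <= th + waste D phi B) /\
  N0 <= #|intact D| + waste D phi B].

Lemma out_large D phi B : closed_set D -> #|B| <= n ->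
  N0 <= #|intact D| + waste D phi B -> (th + Wm + 3) * 24 + 100 <= #|~: D|.
Proof.
move=> cl /waste_le le hI; apply: leq_trans (card_intact cl).
move: (le D phi) hI hN; clear; lia.
Qed.

Lemma out_image D phi v : v \notin phi @: D -> v \in phi @: unfinished D.
Proof.
move=> vD; rewrite -[v](permKV phi); apply: imset_f; rewrite inE.
by apply/orP; left; apply: contraNN vD => h; rewrite -[v](permKV phi) imset_f.
Qed.

Lemma parent_image D phi c : c \notin D -> phi (f c) \in phi @: unfinished D.
Proof.
move=> cD; apply: imset_f; rewrite inE.
by apply/orP; right; apply/existsP; exists c; rewrite eqxx.
Qed.

Lemma in_core_emb D phi M (e : edge n) c y : closed_set D -> in_core D M phi ->
  c \notin D -> f c \in D -> y \notin phi @: D -> val e = [set phi (f c); y] ->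
  in_core (c |: D) (e |: M) (emb phi c y).
Proof.
move=> cl [Mi Me] cD fD yD Ee; split=> [a b|].
  rewrite emb_image // (adjU1 _ _ _ Ee) in_setU1.
  case/orP=> [/orP[]/andP[/eqP-> _]|/Mi->]; last by rewrite orbT.
    by rewrite imset_f ?orbT.
  by rewrite eqxx.
apply: (emb_adj cl cD fD yD Me); first exact: subsetUr.
by rewrite (adjU1 _ _ _ Ee) !eqxx.
Qed.

(** An unfinished vertex has small degree and hence a free edge to a vertex not
yet used. *)
Lemma single_step D phi M B B' k c : core_inv D phi M B k.+1 ->
  B \subset B' -> #|B'| <= #|B|.+1 -> c \notin D -> f c \in D ->
  (forall v, v \in phi @: unfinished D ->
    deg B' v <= th + waste D phi B' + (th < deg B' (phi (f c)))) ->
  N0 <= #|intact (c |: D)| + waste D phi B' + (th < deg B' (phi (f c))) ->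
  exists e phi', [/\ e \notin M, e \notin B' & core_inv (c |: D) phi' (e |: M) B' k].
Proof.
move=> [cl sz szB ic [_ hI]] sB cB cD fD dg' hI'.
have szB' : #|B'| + k <= n by move: szB cB; clear; lia.
have le : #|B| <= n by move: szB; clear; lia.
have le' : #|B'| <= n by move: szB'; clear; lia.
have big := out_large cl le hI.
have [||y [yD _ ya]] := @pick_free D phi B' (th + Wm + 1) [:: phi (f c)] [::].
- move=> v; rewrite inE => /eqP->; apply: leq_trans (dg' _ (parent_image _ cD)) _.
  by rewrite leq_add ?leq_add2l ?waste_le // leq_b1.
- by move: big; rewrite /=; clear; lia.
have nay := ya _ (mem_head _ _).
have neq : phi (f c) != y by apply: contraNneq yD => <-; apply: imset_f.
have [e Ee] := edgeP neq.
exists e, (emb phi c y); split.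
- rewrite (adj_val _ Ee); apply/negP=> a; case: ic => Mi _.
  by rewrite adj_sym in a; rewrite (Mi _ _ a) in yD.
- by rewrite (adj_val _ Ee).
have w' := emb_waste cD fD yD B'.
split=> //.
- exact: emb_closed.
- by rewrite cardsU1 cD add1n addSnnS.
- exact: in_core_emb.
split=> [v /(subsetP (emb_unfinished cD yD))/dg' h|].
  by apply: leq_trans h _; rewrite -addnA leq_add2l; apply: leq_trans w'; rewrite leq_addr.
by apply: leq_trans hI' _; rewrite -addnA leq_add2l; apply: leq_trans w'; rewrite leq_addr.
Qed.

Lemma exit_path D x : closed_set D -> x \notin D ->
  exists j, [/\ iter j f x \notin D, iter j.+1 f x \in D & forall i, i <= j -> iter i f x \notin D].
Proof.
move=> cl xD; have [m Em] := reach x.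
have ex : exists m, iter m f x \in D by exists m; rewrite Em; case: cl.
case: (ex_minnP ex) => [[|j] jD min]; first by rewrite /= jD in xD.
have out i : i <= j -> iter i f x \notin D.
  by move=> ij; apply/negP=> /min; rewrite ltnNge ij.
by exists j; split=> //; apply: out.
Qed.

Lemma deep_chain D : closed_set D -> 0 < #|intact D| ->
  exists c1 c2 c3, [/\ c1 \notin D, c2 \notin D, c3 \notin D, f c1 \in D &
    f c2 = c1 /\ f c3 = c2].
Proof.
move=> cl /card_gt0P[l]; rewrite inE => /andP[_ out].
have lD : l \notin D by apply: contraNN out => h; apply: (@closed_iter D l 0 10).
have [j [j1 j2 j3]] := exit_path cl lD.
have j10 : 10 <= j.
  rewrite leqNgt; apply/negP=> h; case/negP: out.
  exact: (@closed_iter D l j.+1 10).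
case: j j10 j1 j2 j3 => [|[|j]] // _ j1 j2 j3.
exists (iter j.+2 f l), (iter j.+1 f l), (iter j f l); split=> //.
  by apply: j3; rewrite leqW.
by apply: j3; rewrite !leqW.
Qed.

Lemma cross3 (D : {set V}) phi c y : c \notin D -> y \notin phi @: D ->
  forall z, z \notin phi @: D -> z != y -> z \notin emb phi c y @: (c |: D).
Proof. by move=> cD yD z zD zy; rewrite emb_image // !inE negb_or zy. Qed.

(** Three consecutive descendants are embedded at once.  One of the vertices is
dangerous and adds three to the waste, which pays for three Breaker moves and for
up to three pendant paths. *)
Lemma triple_inv D phi M B k c1 c2 c3 y p q (e1 e2 e3 : edge n) :
  closed_set D -> #|D| + k.+3 = n -> #|B| + k <= n -> in_core D M phi ->
  (forall v, v \in phi @: unfinished D -> deg B v <= th + waste D phi B + 3) ->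
  N0 <= #|intact D| + waste D phi B ->
  [/\ c1 \notin D, c2 \notin D, c3 \notin D, f c1 \in D & f c2 = c1 /\ f c3 = c2] ->
  [/\ y \notin phi @: D, p \notin phi @: D & q \notin phi @: D] ->
  [/\ p != y, q != y & q != p] -> (th < deg B p) || (th < deg B q) ->
  val e1 = [set phi (f c1); y] -> val e2 = [set y; p] -> val e3 = [set p; q] ->
  exists D' phi', core_inv D' phi' (e3 |: (e2 |: (e1 |: M))) B k.
Proof.
move=> cl sz szB ic hd hI [c1D c2D c3D fD [f2 f3]] [yD pD qD] [py qy qp] dan E1 E2 E3.
have c21 : c2 != c1.
  by apply: contraNneq c1D => E; move: fD; rewrite -{1}E f2.
have c31 : c3 != c1.
  by apply: contraNneq c2D => E; rewrite -f3 E.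
have c32 : c3 != c2.
  by apply: contraNneq c21 => E; rewrite -f2 -{1}f3 E.
pose D1 := c1 |: D; pose phi1 := emb phi c1 y.
have cl1 : closed_set D1 by apply: emb_closed.
have c2D1 : c2 \notin D1 by rewrite !inE negb_or c21.
have f2D1 : f c2 \in D1 by rewrite f2 setU11.
have pD1 : p \notin phi1 @: D1 by apply: cross3.
have ic1 : in_core D1 (e1 |: M) phi1 by apply: in_core_emb.
pose D2 := c2 |: D1; pose phi2 := emb phi1 c2 p.
have cl2 : closed_set D2 by apply: emb_closed.
have c3D2 : c3 \notin D2 by rewrite !inE !negb_or c32 c31.
have f3D2 : f c3 \in D2 by rewrite f3 setU11.
have qD2 : q \notin phi2 @: D2 by apply: cross3 => //; apply: cross3.
have ic2 : in_core D2 (e2 |: (e1 |: M)) phi2.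
  by apply: in_core_emb => //; rewrite f2 embE.
have ic3 : in_core (c3 |: D2) (e3 |: (e2 |: (e1 |: M))) (emb phi2 c3 q).
  by apply: in_core_emb => //; rewrite f3 embE.
have w1 := emb_waste c1D fD yD B.
have w2 := emb_waste c2D1 f2D1 pD1 B.
have w3 := emb_waste c3D2 f3D2 qD2 B.
have i1 := emb_intact D c1; have i2 := emb_intact D1 c2; have i3 := emb_intact D2 c3.
have ww : waste D phi B + 3 <= waste (c3 |: D2) (emb phi2 c3 q) B.
  have g1 : waste D phi B <= waste D1 phi1 B.
    by apply: leq_trans w1; rewrite -addnA leq_addr.
  have g2 : waste D1 phi1 B + 3 * (th < deg B p) <= waste D2 phi2 B.
    by apply: leq_trans w2; rewrite leq_add2r leq_addr.
  have g3 : waste D2 phi2 B + 3 * (th < deg B q) <= waste (c3 |: D2) (emb phi2 c3 q) B.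
    by apply: leq_trans w3; rewrite leq_add2r leq_addr.
  apply: leq_trans g3; apply: leq_trans (leq_add g2 (leqnn _)).
  apply: leq_trans (leq_add (leq_add g1 (leqnn _)) (leqnn _)).
  case/orP: dan => ->; rewrite muln1; first exact: leq_addr.
  by rewrite leq_add2r leq_addr.
exists (c3 |: D2), (emb phi2 c3 q); split=> //.
- exact: emb_closed.
- by rewrite cardsU1 c3D2 /D2 cardsU1 c2D1 /D1 cardsU1 c1D !add1n -[RHS]sz !addSn !addnS.
have ii : #|intact D| <= #|intact (c3 |: D2)| + 3.
  by rewrite addn3; apply: leq_trans i1 _; rewrite ltnS; apply: leq_trans i2 _.
split=> [v|]; last first.
  by apply: leq_trans hI (leq_trans (leq_add ii (leqnn _)) _); rewrite -addnA leq_add2l addnC.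
move=> /(subsetP (emb_unfinished c3D2 qD2))/(subsetP (emb_unfinished c2D1 pD1)).
move=> /(subsetP (emb_unfinished c1D yD))/hd h; apply: leq_trans h _.
by rewrite -addnA leq_add2l.
Qed.

(** A vertex [v] outside the core with many Breaker edges may have no free edge
into the core, so it is absorbed in three moves: Maker joins it to a fresh vertex
[e], then attaches to the core a vertex [y] for which both [y v] and [y e] are
free, and Breaker can take only one of these. *)
Lemma danger_step D phi M B B' k v : core_inv D phi M B k.+3 ->
  B \subset B' -> #|B'| <= #|B|.+1 -> v \notin phi @: D -> th < deg B' v ->
  (forall D' phi' M' B'', core_inv D' phi' M' B'' k -> mwin setT (embedded r f) k M' B'') ->
  exists e, [/\ e \in setT, e \notin M, e \notin B' & mwin setT (embedded r f) k.+2 (e |: M) B'].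
Proof.
move=> [cl sz szB ic [hd hI]] sB cB vD dan next.
have leB : #|B| <= n by move: szB; clear; lia.
have big := out_large cl leB hI.
have pos : 0 < #|intact D|.
  have w := waste_le D phi leB; move: w hI hN; clear.
  by case: posnP => // ->; lia.
have [c1 [c2 [c3 hc]]] := deep_chain cl pos.
have [_ _ _ fD _] := hc.
have vU := out_image vD.
have d1 z : deg B' z <= deg B z + 1 by rewrite addn1; apply: deg_move.
have kn : forall m, m <= 3 -> forall x (Bx : {set edge n}), (forall z, deg Bx z <= deg B z + m) ->
    x \in phi @: unfinished D -> deg Bx x <= th + Wm + 3.
  move=> m m3 x Bx h xU; apply: leq_trans (h x) _; apply: leq_add => //.
  by apply: leq_trans (hd x xU) _; rewrite leq_add2l waste_le.
have [||e [eD eL ev]] := @pick_free D phi B' (th + Wm + 3) [:: v] [:: v].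
- by move=> x; rewrite inE => /eqP->; apply: (kn 1).
- by move: big => /=; clear; lia.
have nev := ev v (mem_head _ _).
have ve : v != e by move: eL; rewrite inE eq_sym.
have notM a b : a \notin phi @: D -> adj M a b = false.
  by move=> aD; case E: (adj M a b) => //; rewrite (proj1 ic _ _ E) in aD.
have [e1 E1] := edgeP ve.
exists e1; split=> //; rewrite ?(adj_val _ E1) ?notM // => B2 sB2 cB2 _.
have d2 z : deg B2 z <= deg B z + 2.
  by apply: leq_trans (deg_move z sB2 cB2) _; have := d1 z; clear; lia.
have v0D : phi (f c1) \in phi @: D by apply: imset_f.
have [c1D _ _ _ _] := hc.
have [||y [yD yL ya]] := @pick_free D phi B2 (th + Wm + 3) [:: phi (f c1); v; e] [:: v; e].
- move=> x; rewrite !inE => /or3P[]/eqP->; apply: (kn 2) => //.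
  + exact: parent_image.
  + exact: out_image.
- by move: big => /=; clear; lia.
have [yv ye] : y != v /\ y != e by move: yL; rewrite !inE negb_or => /andP[].
have na0 : ~~ adj B2 (phi (f c1)) y by apply: ya; rewrite mem_head.
have nav : ~~ adj B2 v y by apply: ya; rewrite !inE eqxx orbT.
have nae : ~~ adj B2 e y by apply: ya; rewrite !inE eqxx !orbT.
have ne0 : phi (f c1) != y by apply: contraNneq yD => <-.
have [e2 E2] := edgeP ne0.
have v0v : phi (f c1) != v by apply: contraNneq vD => <-.
have v0e : phi (f c1) != e by apply: contraNneq eD => <-.
exists e2; split=> //.
- rewrite (adj_val _ E2) (adjU1 _ _ _ E1) (negbTE v0v) (negbTE v0e) /=.
  by rewrite adj_sym notM.
- by rewrite (adj_val _ E2).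
move=> B3 sB3 cB3 _.
have d3 z : deg B3 z <= deg B z + 3.
  by apply: leq_trans (deg_move z sB3 cB3) _; have := d2 z; clear; lia.
have sBB : B \subset B3 := subset_trans sB (subset_trans sB2 sB3).
have szB3 : #|B3| + k <= n by move: szB cB cB2 cB3; clear; lia.
have hd3 x : x \in phi @: unfinished D -> deg B3 x <= th + waste D phi B3 + 3.
  move=> xU; apply: leq_trans (d3 x) _; rewrite leq_add2r; apply: leq_trans (hd x xU) _.
  by rewrite leq_add2l waste_mono.
have hI3 : N0 <= #|intact D| + waste D phi B3.
  by apply: leq_trans hI _; rewrite leq_add2l waste_mono.
have dan3 : th < deg B3 v.
  by apply: leq_trans dan (deg_mono _ (subset_trans sB2 sB3)).
(* Breaker cannot have claimed both remaining edges at [y] in a single move *)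
have [p [q [hpq pv]]] : exists p q, [\/ p = v /\ q = e | p = e /\ q = v] /\ ~~ adj B3 y p.
  have [h|h] := boolP (adj B3 y v); last by exists v, e; split=> //; left.
  exists e, v; split; first by right.
  have [E|[a [b [ab E]]]] := breaker_move sB3 cB3.
    by rewrite E adj_sym.
  rewrite E adj_sym (negbTE nae) orbF.
  move: h; rewrite E adj_sym (negbTE nav) orbF => h.
  apply/negP=> h'; case/orP: h => /andP[/eqP xa /eqP xb];
    case/orP: h' => /andP[/eqP xa' /eqP xb'].
  - by rewrite xb xb' eqxx in ve.
  - by rewrite -xa -xa' eqxx in ab.
  - by rewrite -xa -xa' eqxx in ab.
  - by rewrite xb xb' eqxx in ve.
have {hpq} [pD qD py qy [qp [E1' dan3']]] : [/\ p \notin phi @: D, q \notin phi @: D,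
    p != y, q != y & q != p /\ val e1 = [set p; q] /\ (th < deg B3 p) || (th < deg B3 q)].
  have [vy ey ev'] : [/\ v != y, e != y & e != v] by rewrite ![_ == y]eq_sym [e == v]eq_sym.
  by case: hpq => -[-> ->]; rewrite dan3 ?orbT; split; rewrite // setUC.
have yp : y != p by rewrite eq_sym.
have [e3 E3] := edgeP yp.
exists e3; split=> //.
- rewrite (adj_val _ E3) (adjU1 _ _ _ E2) (adjU1 _ _ _ E1) notM //.
  have pv0 : p != phi (f c1) by apply: contraNneq pD => ->.
  by rewrite (negbTE yv) (negbTE ye) (negbTE pv0) eq_sym (negbTE ne0) eqxx.
- by rewrite (adj_val _ E3).
have [D' [phi' inv]] := triple_inv cl sz szB3 ic hd3 hI3 hc
  (And3 yD pD qD) (And3 py qy qp) dan3' E2 E3 E1'.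
apply: next; suff -> : e3 |: (e2 |: (e1 |: M)) = e1 |: (e3 |: (e2 |: M)) by exact: inv.
by apply/setP=> x; rewrite !inE orbA orbCA -!orbA; do !bool_congr.
Qed.

Lemma pendant_descend L l i j x : pendant f L l -> i < L ->
  iter j f x = iter i f l -> j <= i /\ x = iter (i - j) f l.
Proof.
move=> /pendantP p; elim: j i => [|j IH] i iL E; first by rewrite subn0.
have [i0 /IH[|ji ->]] := p i (iter j f x) iL E; first by apply: leq_ltn_trans iL; apply: leq_pred.
by case: i i0 ji {iL E} => // i _ ji; rewrite subSS.
Qed.

(** The path from a vertex outside [D] to the root enters [D] just above the second
vertex, counted from the top, of a pendant path; as nothing else hangs there, the
vertex lies on that pendant path. *)
Lemma core_done D : closed_set D ->
  (forall c, c \notin D -> f c \in D -> exists2 l, pendant f 12 l & iter 10 f l = c) ->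
  [/\ forall l, l \in intact D -> pendant f 12 l,
      forall l, l \in intact D -> iter 11 f l \in D,
      forall l i, l \in intact D -> i < 11 -> iter i f l \notin D,
      forall x, x \notin D ->
        exists p : V * nat, [/\ p.1 \in intact D, p.2 < 11 & x = iter p.2 f p.1] &
      #|~: D| = #|intact D| * 11].
Proof.
move=> cl core.
have g1 l : l \in intact D -> pendant f 12 l by rewrite inE => /andP[].
have g3 l i : l \in intact D -> i < 11 -> iter i f l \notin D.
  rewrite inE => /andP[_ out] iL; apply: contraNN out => xD.
  exact: (@closed_iter D l i 10 cl _ xD).
have g4 x : x \notin D ->
    exists p : V * nat, [/\ p.1 \in intact D, p.2 < 11 & x = iter p.2 f p.1].
  move=> xD; have [j [j1 j2 _]] := exit_path cl xD.
  have [l pl El] := core _ j1 j2.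
  have [j10 Ex] := pendant_descend pl (isT : 10 < 12) (esym El).
  exists (l, 10 - j); split=> //=; first by rewrite inE pl El.
  by rewrite ltnS leq_subr.
split=> //.
  move=> l lG; apply/negPn/negP=> /g4[[l' i] /= [l'G iL E]].
  have [_ E'] : l = l' /\ 11 = i.
    by apply: (pendant_inj (g1 _ lG) (g1 _ l'G)) => //; apply: leqW.
  by rewrite -E' in iL.
apply/eqP; rewrite eqn_leq card_intact // andbT.
apply: leq_trans (card_bigcup_const (F := fun l => [set iter i f l | i : 'I_11]) (c := 11) _).
  apply/subset_leq_card/subsetP=> x; rewrite inE => /g4[[l i] /= [lG iL ->]].
  by apply/bigcupP; exists l => //; apply/imsetP; exists (Ordinal iL).
by move=> l _; apply: leq_trans (leq_imset_card _ _) _; rewrite card_ord.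
Qed.

(** Dangerous vertices are served first: a dangerous parent gets its next child,
and a dangerous free vertex is absorbed.  Otherwise all degrees are at most [th]
and any core vertex may be embedded.  When none is left, the degrees are small
enough for a clean assignment. *)
Lemma core_win k D phi M B : core_inv D phi M B k -> mwin setT (embedded r f) k M B.
Proof.
have [m] := ubnP k; elim: m k D phi M B => // m IH k D phi M B; rewrite ltnS => km inv.
have [cl sz szB [Mi Me] [hd hI]] := inv.
have leB : #|B| <= n by move: szB; clear; lia.
have big := out_large cl leB hI.
have cD : #|~: D| = k.
  by have := cardsC D; rewrite card_ord -[X in _ = X -> _]sz => /addnI.
pose core c := [&& c \notin D, f c \in D & [forall l, pendant f 12 l ==> (iter 10 f l != c)]].
have [/existsP[c0 /and3P[c0D f0D /forallP c0core]]|] := boolP [exists c, core c]; last first.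
  rewrite negb_exists => /forallP nocore.
  have [|g1 g2 g3 g4 g5] := @core_done D cl.
    move=> c cD' fD; have := nocore c; rewrite /core cD' fD /= negb_forall.
    by case/existsP=> l; rewrite negb_imply negbK => /andP[pl /eqP El]; exists l.
  have [||psi [psiD clean]] := @clean_assignment n f D (intact D) g1 g3 B (th + Wm) phi.
  - move=> x hx; have xU : x \in unfinished D.
      case: hx => [xD|[l lG xl]]; first by rewrite inE xD.
      rewrite inE; case: (boolP (x \in D)) => //= xD.
      apply/existsP; exists (iter 10 f l); rewrite g3 // andbT.
      by rewrite (chain_D g3 lG xl xD).
    apply: leq_trans (hd _ (imset_f _ xU)) _.
    by rewrite leq_add2l waste_le.
  - by move: big; clear; lia.
  have psiI : psi @: D = phi @: D by apply: eq_in_imset.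
  have -> : k = #|intact D| * 11 by rewrite -g5 cD.
  have [rD clD] := cl.
  apply: (@endgame_win n r f D (intact D) g1 g2 g3 g4 M B psi) => //.
  - by move=> a b /Mi; rewrite psiI.
  - by move=> x xD xr; rewrite !psiD ?clD //; apply: Me.
have k3 : 3 <= k by rewrite -cD; move: big; clear; lia.
case: k k3 km inv sz szB cD => // k k3 km inv sz szB cD B' sB cB dB.
have szB' : #|B'| + k <= n by move: szB cB; clear; lia.
have hd1 v : v \in phi @: unfinished D -> deg B' v <= th + waste D phi B' + 1.
  move=> vU; rewrite addn1; apply: leq_trans (deg_move v sB cB) _; rewrite ltnS.
  by apply: leq_trans (hd v vU) _; rewrite leq_add2l waste_mono.
have hI1 : N0 <= #|intact D| + waste D phi B'.
  by apply: leq_trans hI _; rewrite leq_add2l waste_mono.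
have step c : c \notin D -> f c \in D ->
    (forall v, v \in phi @: unfinished D ->
      deg B' v <= th + waste D phi B' + (th < deg B' (phi (f c)))) ->
    N0 <= #|intact (c |: D)| + waste D phi B' + (th < deg B' (phi (f c))) ->
    exists e, [/\ e \in [set: edge n], e \notin M, e \notin B' &
      mwin setT (embedded r f) k (e |: M) B'].
  move=> cD' fD h1 h2; have [e [phi' [e1 e2 i]]] := single_step inv sB cB cD' fD h1 h2.
  exists e; split=> //; apply: IH i; exact: km.
have [/existsP[c /and3P[cD' fD dan]]|] := boolP [exists c, [&& c \notin D, f c \in D & th < deg B' (phi (f c))]].
  apply: (step c) => //; rewrite dan //.
  apply: leq_trans hI1 _; rewrite addn1 -addSn leq_add2r; exact: emb_intact.
rewrite negb_exists => /forallP nopen.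
have [/existsP[v /andP[vD dan]]|] := boolP [exists v, (v \notin phi @: D) && (th < deg B' v)].
  case: k k3 km inv {sz szB cD szB' step} => [|[|k]] // _ km inv.
  apply: (danger_step inv sB cB vD dan) => D' phi' M' B'' i.
  by apply: IH i; move: km; clear; lia.
rewrite negb_exists => /forallP nosingle.
have hd0 v : v \in phi @: unfinished D -> deg B' v <= th.
  case/imsetP=> x; rewrite inE => /orP[xD|/existsP[y /andP[/eqP fy yD]]] ->.
    have := nosingle (phi x); rewrite (mem_imset _ _ (@perm_inj _ phi)) xD /=.
    by rewrite -leqNgt.
  have [xD|xD] := boolP (x \in D).
    by have := nopen y; rewrite yD fy xD /= -leqNgt.
  have := nosingle (phi x); rewrite (mem_imset _ _ (@perm_inj _ phi)) xD /=.
  by rewrite -leqNgt.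
apply: (step c0) => //.
  by move=> v /hd0 h; apply: leq_trans h _; rewrite -addnA leq_addr.
have ii : #|intact D| <= #|intact (c0 |: D)|.
  by apply: emb_intact_core => l pl; have /implyP := c0core l; apply.
by apply: leq_trans hI1 _; apply: leq_trans (leq_addr _ _); rewrite leq_add2r.
Qed.

End Core.
(** * Trees as parent functions *)

Section Parent.
Variables (n : nat) (r : 'I_n).
Local Notation V := 'I_n.
Implicit Types (f g : {ffun 'I_n -> 'I_n}) (T : {set edge n}).

Definition parent_fun f := (f r == r) && [forall x, fconnect f x r].

Lemma parentP f : reflect (f r = r /\ forall x, exists i, iter i f x = r) (parent_fun f).
Proof.
apply: (iffP andP) => [[/eqP fr /forallP c]|[fr c]]; split=> //.
- by move=> x; exists (findex f x r); apply: iter_findex.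
- exact/eqP.
- by apply/forallP=> x; have [i <-] := c x; apply: fconnect_iter.
Qed.

Lemma parent_depth f : parent_fun f ->
  exists d : V -> nat, forall x, x != r -> d x = (d (f x)).+1.
Proof.
move=> /parentP[fr c].
have ex x : exists i, iter i f x == r by have [i <-] := c x; exists i.
exists (fun x => ex_minn (ex x)) => x xr.
case: ex_minnP => [[|m]]; first by rewrite /= (negbTE xr).
rewrite iterSr => Em minm; case: ex_minnP => m' Em' minm'.
by apply/eqP; rewrite eqSS eqn_leq minm' // -ltnS minm // iterSr.
Qed.

Lemma parent_neq f x : parent_fun f -> x != r -> f x != x.
Proof.
move=> /parent_depth[d Hd] xr; apply/eqP=> E; have := Hd x xr; rewrite E.
by move/eqP; rewrite -[X in X == _]addn0 -addn1 eqn_add2l.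
Qed.

Definition tree_of f : {set edge n} :=
  [set e | [exists x, (x != r) && (val e == [set x; f x])]].

Lemma adj_tree_of f x y : parent_fun f ->
  adj (tree_of f) x y = (x != r) && (f x == y) || (y != r) && (f y == x).
Proof.
move=> pf; apply/adjP/orP => [[e]|].
  rewrite inE => /existsP[z /andP[zr /eqP->]] /eqP.
  by rewrite set2_eq => /orP[]/andP[/eqP<- /eqP<-]; [left|right]; rewrite zr eqxx.
case=> /andP[zr /eqP E].
  have := parent_neq pf zr; rewrite E => h; have [|e Ee] := @edgeP _ x y; first by rewrite eq_sym.
  by exists e => //; rewrite inE; apply/existsP; exists x; rewrite zr Ee E eqxx.
have := parent_neq pf zr; rewrite E => h; have [e Ee] := edgeP h.
by exists e => //; rewrite inE; apply/existsP; exists y; rewrite zr Ee E setUC eqxx.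
Qed.

Lemma embedded_copy f M : parent_fun f -> embedded r f M ->
  exists2 W, W \in copies (tree_of f) & W \subset M.
Proof.
move=> pf [phi H].
exists [set e in M | [exists x, (x != r) && (val e == [set phi x; phi (f x)])]]; last first.
  by apply/subsetP=> e; rewrite inE => /andP[].
rewrite inE; apply/existsP; exists phi; apply/forallP=> x; apply/forallP=> y.
rewrite (adj_tree_of _ _ pf); apply/eqP; apply/idP/idP.
  case/adjP=> e; rewrite inE => /andP[_ /existsP[z /andP[zr /eqP->]]] /eqP.
  by rewrite set2_eq => /orP[]/andP[/eqP/perm_inj<- /eqP/perm_inj<-]; rewrite zr eqxx ?orbT.
case/orP=> /andP[zr /eqP<-]; last rewrite adj_sym.
  have /adjP[e eM Ee] := H x zr; apply/adjP; exists e => //; rewrite inE eM.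
  by apply/existsP; exists x; rewrite zr Ee eqxx.
have /adjP[e eM Ee] := H y zr; apply/adjP; exists e => //; rewrite inE eM.
by apply/existsP; exists y; rewrite zr Ee eqxx.
Qed.

Lemma tree_of_connected f : parent_fun f -> connected_graph (tree_of f).
Proof.
move=> pf; have [fr c] := parentP _ pf.
have cr x : connect (adj (tree_of f)) x r.
  have [i Ei] := c x; elim: i x Ei => [x <-|i IH x]; first exact: connect0.
  rewrite iterSr => Ei; have [->|xr] := eqVneq x r; first exact: connect0.
  by apply: connect_trans (connect1 _) (IH _ Ei); rewrite adj_tree_of // xr eqxx.
move=> x y; apply: connect_trans (cr x) _.
by rewrite sym_connect_sym //; apply: adj_sym.
Qed.

(** On a cycle, both neighbours of a vertex of maximal depth are its parent. *)
Lemma tree_of_acyclic f : parent_fun f -> acyclic_graph (tree_of f).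
Proof.
move=> pf c /andP[cy U]; have [d Hd] := parent_depth pf.
rewrite leqNgt; apply/negP=> s3.
have [x0 x0c] : exists x, x \in c by case: c s3 {cy U} => // x c; exists x; rewrite mem_head.
case: (@arg_maxnP _ x0 (mem c) d x0c) => x xc max.
have par y : y \in c -> adj (tree_of f) x y -> y = f x.
  move=> yc; rewrite adj_tree_of // => /orP[/andP[_ /eqP->]//|/andP[yr /eqP E]].
  by have := max y yc; rewrite (Hd y yr) E /= ltnn.
have [i s Es] := rot_to xc.
move: cy U s3; rewrite -(rot_cycle i) -(rot_uniq i) -(size_rot i) Es /=.
have mc y : y \in x :: s -> y \in c by rewrite -Es mem_rot.
case: s mc {Es} => [|y [|z s]] //= mc.
rewrite rcons_path => /and3P[xy _ /andP[_ lx]] /and3P[_ + _] _.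
have Ey : y = f x by apply: par => //; apply: mc; rewrite !inE eqxx orbT.
have El : last z s = f x.
  by apply: par; [apply: mc; rewrite 2!in_cons mem_last !orbT | rewrite adj_sym].
by rewrite Ey -El mem_last.
Qed.

(** Two parent functions with the same tree agree from the root upwards: if the
parents of [x] differed, [x] would be the parent of its own parent. *)
Lemma tree_of_inj : {in parent_fun &, injective tree_of}.
Proof.
move=> f g pf pg E; have [fr c] := parentP _ pf; have [gr _] := parentP _ pg.
apply/ffunP=> x; have [i Ei] := c x.
elim: i x Ei => [x /= ->|i IH x]; first by rewrite fr gr.
rewrite iterSr => Ei; have [->|xr] := eqVneq x r; first by rewrite fr gr.
have := adj_tree_of x (f x) pf; rewrite E adj_tree_of // xr eqxx /=.
case/orP=> [/eqP//|/andP[fxr /eqP gx]].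
have := IH _ Ei; rewrite gx => ffx.
have [d Hd] := parent_depth pf; have := Hd _ fxr; have := Hd x xr; rewrite ffx.
by move: (d x) (d (f x)); clear; lia.
Qed.

(** The parent is a neighbour closer to the root.  An edge of [T] missing from the
resulting connected subgraph would close a cycle. *)
Lemma tree_of_surj T : is_tree T -> exists2 f, parent_fun f & tree_of f = T.
Proof.
move=> [con acy].
pose P x i := exists p, [/\ path (adj T) x p, last x p = r & size p = i].
have ex x : exists i, `[< P x i >].
  have /connectP[p pp E] := con x r; exists (size p); apply/asboolP.
  by exists p.
pose d x := ex_minn (ex x).
have dP x : P x (d x) by rewrite /d; case: ex_minnP => m /asboolP.
have dmin x i : P x i -> d x <= i.
  by rewrite /d; case: ex_minnP => m _ min Pi; apply: min; apply/asboolP.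
have /boolp.choice[g Hg] : forall x, exists y, (x != r) ==> (adj T x y && (d y < d x)).
  move=> x.
  have [->|xr] := eqVneq x r; first by exists r.
  have [p [pp lp sp]] := dP x; case: p pp lp sp => [_ E|y p /= /andP[xy pp] lp sp].
    by rewrite -E eqxx in xr.
  exists y; rewrite xy -sp ltnS /=; apply: dmin; by exists p.
pose f : {ffun V -> V} := [ffun x => if x == r then r else g x].
have fr : f r = r by rewrite ffunE eqxx.
have fx x : x != r -> adj T x (f x) && (d (f x) < d x).
  by move=> xr; have /implyP/(_ xr) := Hg x; rewrite ffunE (negbTE xr).
have pf : parent_fun f.
  apply/parentP; split=> // x.
  have [m] := ubnP (d x); elim: m x => // m IH x; rewrite ltnS => le.
  have [->|xr] := eqVneq x r; first by exists 0.
  have /andP[_ lt] := fx x xr; have [i Ei] := IH _ (leq_trans lt le).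
  by exists i.+1; rewrite iterSr.
have sub : tree_of f \subset T.
  apply/subsetP=> e; rewrite inE => /existsP[x /andP[xr /eqP Ee]].
  by rewrite (adj_val _ Ee); case/andP: (fx x xr).
exists f => //; apply/eqP; rewrite eqEsubset sub /=; apply/subsetP=> e eT.
have [x [y [xy Ee]]] := edge_ends e; apply/negPn/negP=> ef.
move: eT ef; rewrite !(adj_val _ Ee) => axy naxy.
have /connectP[p pp Ey] := tree_of_connected pf x y.
case/shortenP: pp Ey => p' pp' Up' _ Ey.
have := acy (x :: p'); rewrite /ucycle /= rcons_path -Ey [adj T y x]adj_sym axy.
rewrite (sub_path _ pp') => [|u v]; last exact: adjS.
move=> /(_ Up'); case: p' pp' Up' Ey => [_ _ E|z [|z' p'']] //.
  by rewrite E eqxx in xy.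
by move=> /= /andP[xz _] _ E; rewrite E xz in naxy.
Qed.

Lemma labeled_treesE : labeled_trees n = tree_of @: parent_fun.
Proof.
apply/setP=> T; rewrite inE; apply/asboolP/imsetP => [/tree_of_surj[f pf <-]|[f pf ->]].
  by exists f.
by split; [apply: tree_of_connected | apply: tree_of_acyclic].
Qed.

End Parent.

(** * Switchings *)

(** Double counting: a choice [u] in [S f] turns [f] into another object [h f u],
and the trace [k f u] left in [R] tells how to go back. *)
Lemma switching (T U W : finType) (A F : {set T}) (S : T -> {set U}) (R : T -> {set W})
    (h : T -> U -> T) (k : T -> U -> W) (inv : T -> W -> T * U) :
  (forall f u, f \in A -> u \in S f ->
    [/\ h f u \in F, k f u \in R (h f u) & inv (h f u) (k f u) = (f, u)]) ->
  \sum_(f in A) #|S f| <= \sum_(f in F) #|R f|.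
Proof.
move=> H.
have pairs (I J : finType) (P : {set I}) (Q : I -> {set J}) :
    \sum_(i in P) #|Q i| = #|[set p : I * J | (p.1 \in P) && (p.2 \in Q p.1)]|.
  rewrite -sum1dep_card -(pair_big_dep (mem P) (fun i => mem (Q i)) (fun _ _ => 1)) /=.
  by apply: eq_bigr => i _; rewrite sum1_card.
rewrite !pairs; pose hk (p : T * U) := (h p.1 p.2, k p.1 p.2).
rewrite -(@card_in_imset _ _ hk); last first.
  move=> [f u] [f' u']; rewrite !inE /= => /andP[fA uS] /andP[fA' uS'] [E1 E2].
  have [_ _ I] := H f u fA uS; have [_ _ I'] := H f' u' fA' uS'.
  by rewrite -I -I' E1 E2.
apply/subset_leq_card/subsetP=> q /imsetP[[f u]]; rewrite inE /= => /andP[fA uS] ->.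
by have [h1 h2 _] := H f u fA uS; rewrite inE h1.
Qed.

Section Switch.
Variables (n : nat) (r : 'I_n).
Local Notation V := 'I_n.
Implicit Types (f g : {ffun 'I_n -> 'I_n}).

Definition parents : {set {ffun 'I_n -> 'I_n}} := [set f | parent_fun r f].

Definition upd f y z : {ffun 'I_n -> 'I_n} := [ffun x => if x == y then z else f x].

Lemma updE f y z : upd f y z y = z.
Proof. by rewrite ffunE eqxx. Qed.

Lemma updN f y z x : x != y -> upd f y z x = f x.
Proof. by rewrite ffunE => /negbTE->. Qed.

Lemma upd_upd f y z : upd (upd f y z) y (f y) = f.
Proof. by apply/ffunP=> x; rewrite !ffunE; case: eqP => // ->. Qed.

Lemma iter_upd f y z x i : (forall j, j < i -> iter j f x != y) ->
  iter i (upd f y z) x = iter i f x.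
Proof.
elim: i => //= i IH av; rewrite IH => [|j ji]; last exact/av/leqW.
by rewrite updN // av.
Qed.

(** The new way from [y] to the root leads to [z] and on along the old path, which
avoids [y]; all other paths stay as they are up to their first visit to [y]. *)
Lemma upd_parent f y z : parent_fun r f -> y != r ->
  (forall i, iter i f z != y) -> parent_fun r (upd f y z).
Proof.
move=> /parentP[fr c] yr av; apply/parentP; split.
  by rewrite updN // eq_sym.
have cz : exists i, iter i (upd f y z) z = r.
  by have [i Ei] := c z; exists i; rewrite iter_upd.
move=> x; have [i Ei] := c x; elim: i x Ei => [|i IH] x Ei; first by exists 0.
have [->|xy] := eqVneq x y.
  by have [j Ej] := cz; exists j.+1; rewrite iterSr updE.
rewrite iterSr in Ei; have [j Ej] := IH _ Ei.
by exists j.+1; rewrite iterSr updN.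
Qed.

Lemma parent_no_cycle f x i : parent_fun r f -> x != r -> iter i.+1 f x != x.
Proof.
move=> pf xr; have [d Hd] := parent_depth pf; have [fr _] := parentP _ _ pf.
have dec j : iter j f x != r -> d x = d (iter j f x) + j.
  elim: j => [|j IH] /=; first by rewrite addn0.
  move=> h; have h' : iter j f x != r by apply: contraNneq h => ->; rewrite fr.
  by rewrite IH // Hd // addSnnS.
apply/eqP=> E; have := dec i.+1; rewrite E xr => /(_ isT).
by move: (d x); clear; lia.
Qed.

(** ** Siblings and degrees *)

Definition siblings f : {set V * V} :=
  [set p | [&& p.1 != r, f p.2 == f p.1 & p.2 != p.1]].

(** Hanging a vertex below its sibling can be undone, so that pairs of siblings
are rare. *)
Lemma sum_siblings : \sum_(f in parents) #|siblings f| <= #|parents| * n.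
Proof.
have -> : #|parents| * n = \sum_(f in parents) #|[set: V]|.
  by rewrite sum_nat_const cardsT card_ord.
apply: (@switching _ _ _ parents parents siblings (fun=> setT)
  (fun f p => upd f p.1 p.2) (fun _ p => p.1)
  (fun g y => (upd g y (g (g y)), (y, g y)))) => f [y x].
rewrite !inE /= => pf /and3P[yr /eqP fxy xy].
rewrite !updE updN // fxy upd_upd; split=> //.
apply: upd_parent => // i; case: i => [|i] //.
apply/eqP=> E; have := @parent_no_cycle f y i pf yr.
by rewrite iterSr -fxy -iterSr E eqxx.
Qed.

Definition fiber f p := [set x | f x == p].

(** A vertex with more than [D] children has at least [D ^ 2] pairs of children. *)
Lemma card_bad_degree D :
  #|[set f in parents | [exists p, D < #|fiber f p|]]| * (D * D) <= #|parents| * n.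
Proof.
apply: leq_trans sum_siblings; rewrite -sum_nat_const.
rewrite big_mkcond [X in _ <= X]big_mkcond; apply: leq_sum => f _.
rewrite inE; case: (f \in parents) => //=; case: ifP => // /existsP[p lt].
have -> : #|siblings f| = \sum_(y | y != r) #|[set x | (f x == f y) && (x != y)]|.
  rewrite -sum1dep_card.
  rewrite -(pair_big_dep (fun y => y != r) (fun y x => (f x == f y) && (x != y)) (fun _ _ => 1)) /=.
  by apply: eq_bigr => y _; rewrite sum1dep_card.
apply: (@leq_trans (\sum_(y in fiber f p :\ r) D)).
  rewrite sum_nat_const leq_mul2r; apply/orP; right.
  move: lt; rewrite (cardsD1 r (fiber f p)).
  by case: (r \in fiber f p) => /=; rewrite ?add1n ?ltnS // add0n; apply: ltnW.
rewrite big_mkcond [X in _ <= X]big_mkcond; apply: leq_sum => y _.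
rewrite !inE; case: (y != r) => //=; case: eqP => //= fy.
move: lt; rewrite (cardsD1 y) inE fy eqxx add1n ltnS => h; apply: leq_trans h _.
by apply/subset_leq_card/subsetP=> x; rewrite !inE => /andP[-> ->].
Qed.

(** ** Leaves *)

Definition ends_of L f := [set l | pendant f L l].

Lemma leafP f l : reflect (forall y, f y <> l) (l \in ends_of 1 f).
Proof.
rewrite inE; apply: (iffP (@pendantP _ f 1 l)) => [H y E|H [|i] y // _ E].
  by have [] := H 0 y isT E.
by case: (H y).
Qed.

Definition only_children f := [set y | (y != r) && (#|fiber f (f y)| == 1)].

(** Counting vertices by their parents: [n] is the sum of the fiber sizes, and a
fiber that is neither empty nor a singleton has size at least two. *)
Lemma card_only_children f : n <= #|only_children f| + (#|ends_of 1 f|.*2).+1.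
Proof.
have a0 : #|[set y | #|fiber f (f y)| == 1]| <= #|only_children f|.+1.
  apply: (@leq_trans #|only_children f :|: [set r]|).
    by apply/subset_leq_card/subsetP=> y; rewrite !inE => ->; case: (y == r).
  by apply: leq_trans (leq_card_setU _ _) _; rewrite cards1 addn1.
have part (P : pred V) : \sum_(y | P y) 1 = \sum_p \sum_(y | P y && (f y == p)) 1.
  by rewrite (partition_big f predT).
have e1 : n = \sum_p #|fiber f p|.
  rewrite -[LHS]card_ord -sum1_card part; apply: eq_bigr => p _.
  by rewrite sum1dep_card; congr #|pred_of_set _|; apply/setP=> y; rewrite !inE.
have e2 : #|[set y | #|fiber f (f y)| == 1]| = \sum_p (#|fiber f p| == 1).
  rewrite -sum1dep_card part; apply: eq_bigr => p _.
  rewrite (eq_bigl (fun y => (#|fiber f p| == 1) && (f y == p))); last first.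
    by move=> y; rewrite andbC [RHS]andbC; case: eqP => [->|].
  case: eqP => [E|_] /=; last by rewrite big_pred0.
  by rewrite sum1dep_card -[RHS]E.
have e3 : #|ends_of 1 f| = \sum_p (#|fiber f p| == 0).
  rewrite -sum1_card big_mkcond; apply: eq_bigr => p _.
  rewrite cards_eq0; case: leafP => H.
    suff -> : fiber f p == set0 by [].
    by apply/eqP/setP=> y; rewrite !inE; apply/eqP.
  have [E|//] := eqVneq (fiber f p) set0.
  case: H => y fy; have : y \in fiber f p by rewrite inE fy.
  by rewrite E inE.
have le : n * 2 <= \sum_p (#|fiber f p| + (#|fiber f p| == 1) + (#|fiber f p| == 0) + (#|fiber f p| == 0)).
  rewrite -{1}(card_ord n) -sum_nat_const; apply: leq_sum => p _.
  by case: #|fiber f p| => [|[|m]].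
rewrite !big_split /= -e1 -e2 -e3 in le.
by move: le a0; clear; lia.
Qed.

(** Hanging an only child [y] next to an unrelated vertex [x] makes the parent of
[y] a leaf; the pair of siblings [y], [x] and that leaf tell how to go back. *)
Lemma card_few_leaves k :
  #|[set f in parents | #|ends_of 1 f| <= k]| * ((n - k.*2 - 1) * (n - k.*2 - 2)) <=
  (#|parents| * n * k.+1).*2.
Proof.
pose A := [set f in parents | #|ends_of 1 f| <= k].
pose S f := [set q : V * V | [&& q.1 \in only_children f, q.2 \in only_children f,
  q.2 != q.1 & ~~ fconnect f q.2 q.1]].
pose R f := if #|ends_of 1 f| <= k.+1 then
  setX (ends_of 1 f) (siblings f) else set0.
have low f : f \in A -> (n - k.*2 - 1) * (n - k.*2 - 2) <= #|S f|.*2.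
  rewrite !inE => /andP[pf le]; have := card_only_children f.
  set C := only_children f => ge.
  have cC : n - k.*2 - 1 <= #|C| by move: ge le; clear; lia.
  apply: (@leq_trans (#|C| * (#|C| - 1))).
    by apply: leq_mul => //; move: cC; clear; lia.
  (* of two only children, one at least is not an ancestor of the other *)
  pose S' := [set q | (q.2, q.1) \in S f].
  have cS' : #|S'| = #|S f|.
    pose sw (q : V * V) := (q.2, q.1).
    have bsw : bijective sw by exists sw => -[].
    rewrite -(@on_card_preimset _ _ sw (S f)); last exact: onW_bij.
    by congr #|pred_of_set _|; apply/setP=> q; rewrite !inE.
  rewrite -addnn -{2}cS'; apply: leq_trans (leq_card_setU _ _).
  have -> : #|C| * (#|C| - 1) = \sum_(y in C) #|C :\ y|.
    rewrite -sum_nat_const; apply: eq_bigr => y yC.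
    by rewrite (cardsD1 y C) yC addKn.
  have -> : \sum_(y in C) #|C :\ y| = #|[set q : V * V | (q.1 \in C) && (q.2 \in C :\ q.1)]|.
    rewrite -sum1dep_card -(pair_big_dep (mem C) (fun y => mem (C :\ y)) (fun _ _ => 1)) /=.
    by apply: eq_bigr => y _; rewrite sum1_card.
  apply/subset_leq_card/subsetP=> -[y x]; rewrite !inE /=.
  case/andP=> /andP[yr y1] /and3P[xy xr x1]; rewrite yr xr y1 x1 xy [y == x]eq_sym xy /=.
  rewrite -negb_and; apply/negP=> /andP[/iter_findex E1 /iter_findex E2].
  set i := findex f x y in E1; set j := findex f y x in E2.
  have E : iter (j + i) f x = x by rewrite iterD E1 E2.
  case ij : (j + i) E => [|m] E.
    by move: ij E1; case: i => [|i]; rewrite ?addnS // => _ /= E1; rewrite E1 eqxx in xy.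
  by have := @parent_no_cycle f x m pf xr; rewrite E eqxx.
have up : \sum_(f in parents) #|R f| <= #|parents| * n * k.+1.
  apply: leq_trans (leq_mul sum_siblings (leqnn _)); rewrite big_distrl /=.
  apply: leq_sum => f _; rewrite /R; case: ifP => [le|_]; last by rewrite cards0.
  by rewrite cardsX mulnC leq_mul2l le orbT.
apply: (@leq_trans (\sum_(f in A) #|S f|.*2)).
  by rewrite -sum_nat_const; apply: leq_sum.
have -> : \sum_(f in A) #|S f|.*2 = (\sum_(f in A) #|S f|).*2.
  by rewrite -addnn -big_split; apply: eq_bigr => f _; rewrite -addnn.
rewrite leq_double.
apply: leq_trans up.
apply: (@switching _ _ _ A parents S R (fun f q => upd f q.1 (f q.2))
  (fun f q => (f q.1, q)) (fun g w => (upd g w.2.1 w.1, w.2))) => f [y x].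
rewrite !inE /= => /andP[pf le] /and4P[/andP[yr y1] /andP[xr x1] xy nc].
rewrite upd_upd; split=> //.
  apply: upd_parent => // i; apply: contraNneq nc => <-.
  by rewrite -iterSr fconnect_iter.
set g := upd f y (f x).
have fx z : f z = f y -> z = y.
  move=> E; have /cards1P[w Ew] := y1.
  have : z \in fiber f (f y) by rewrite inE E.
  have : y \in fiber f (f y) by rewrite inE.
  by rewrite Ew !inE => /eqP-> /eqP.
have leaf : f y \in ends_of 1 g.
  apply/leafP=> z; have [->|zy] := eqVneq z y.
    by rewrite updE => /fx E; rewrite E eqxx in xy.
  by rewrite updN // => /fx E; rewrite E eqxx in zy.
have leG : #|ends_of 1 g| <= k.+1.
  apply: (@leq_trans #|f y |: ends_of 1 f|).
    apply/subset_leq_card/subsetP=> z /leafP zl; rewrite in_setU1.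
    have [//|zfy /=] := eqVneq z (f y).
    apply/leafP=> w E; have [wy|wy] := eqVneq w y; first by rewrite -E wy eqxx in zfy.
    by case: (zl w); rewrite updN.
  by apply: leq_trans (card_setU1_le _ _) _.
by rewrite /R leG inE /= leaf inE /= yr xy updN // updE eqxx.
Qed.

(** ** Longer pendant paths *)

Lemma pendant_upd i f l y : parent_fun r f -> pendant f i.+1 l -> pendant f 1 y ->
  y != l -> pendant (upd f y l) i.+2 y.
Proof.
move=> pf /pendantP pl py yl.
have nf w : f w <> y by apply/leafP; rewrite inE.
have ny j : iter j f l != y.
  by case: j => [|j]; [rewrite eq_sym | apply/eqP/nf].
have it j : iter j.+1 (upd f y l) y = iter j f l.
  by rewrite iterSr updE iter_upd.
apply/pendantP=> -[|j] w jL E.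
  have [wy|wy] := eqVneq w y; first by rewrite wy updE in E; rewrite E eqxx in yl.
  by rewrite updN // in E; case: (nf w).
split=> //; rewrite it in E; have [wy|wy] := eqVneq w y.
  rewrite wy updE in E; case: j jL E => [|j] jL E //.
  by have [] := pl 0 (iter j f l) isT (esym E).
rewrite updN // in E; have [j0 ->] := pl j w jL E.
by case: j j0 {jL E} => // j _; rewrite it.
Qed.

Lemma pendant_upd_inv i f l y z : pendant (upd f y l) i z ->
  (forall j, j < i -> iter j (upd f y l) z \notin [:: y; l; f y]) -> pendant f i z.
Proof.
move=> /pendantP pz av.
have it j : j < i -> iter j (upd f y l) z = iter j f z.
  elim: j => //= j IH ji; rewrite -IH; last exact: ltnW.
  by rewrite updN //; have := av j (ltnW ji); rewrite !inE negb_or => /andP[].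
apply/pendantP=> j w ji E.
have wy : w != y.
  by have := av j ji; rewrite it // -E; apply: contraNneq => ->; rewrite !inE eqxx !orbT.
have [j0 ->] := pz j w ji (etrans (updN _ _ wy) (etrans E (esym (it j ji)))).
by split=> //; rewrite it //; case: j j0 ji {E} => // j _ /ltnW.
Qed.

(** A pendant path that is new must pass through [y], through its new parent or
through its old one, and each vertex lies on at most one. *)
Lemma card_pendant_upd i f l y :
  #|ends_of i (upd f y l)| <= #|ends_of i f| + 3.
Proof.
set g := upd f y l.
pose Z : {set V} := [set z in [:: y; l; f y]].
pose hit v := [set z in ends_of i g | [exists j : 'I_i, iter j g z == v]].
have hit1 v : #|hit v| <= 1.
  apply/card_le1_eqP=> z z'; rewrite !inE => /andP[p /existsP[j /eqP E]].
  case/andP=> p' /existsP[j' /eqP E'].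
  by have [] := pendant_inj p p' (ltn_ord j) (ltn_ord j') (etrans E (esym E')).
apply: (@leq_trans #|ends_of i f :|: \bigcup_(v in Z) hit v|).
  apply/subset_leq_card/subsetP=> z zg; rewrite in_setU.
  have [/existsP[j jz]|] := boolP [exists j : 'I_i, iter j g z \in [:: y; l; f y]].
    apply/orP; right; apply/bigcupP; exists (iter j g z); first by rewrite inE.
    by rewrite inE zg; apply/existsP; exists j.
  rewrite negb_exists => /forallP H; apply/orP; left; rewrite inE.
  move: zg; rewrite inE => zg; apply: (pendant_upd_inv zg) => j ji.
  exact: (H (Ordinal ji)).
apply: leq_trans (leq_card_setU _ _) _; rewrite leq_add2l.
apply: leq_trans (card_bigcup_const (c := 1) _) _; first by move=> v _; apply: hit1.
by rewrite muln1 cardsE; apply: leq_trans (card_size _) _.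
Qed.

(** Hanging a leaf below the end of a pendant path makes the path longer; the new
end and the old parent of the leaf tell how to go back. *)
Lemma card_few_pendant i a b k :
  #|[set f in parents | [&& a <= #|ends_of i.+1 f|, b <= #|ends_of 1 f| & #|ends_of i.+2 f| <= k]]|
    * (a * (b - 1)) <= #|parents| * (n * (k + 3)).
Proof.
set A := [set f in parents | _].
pose S f := [set q : V * V | [&& q.1 \in ends_of i.+1 f, q.2 \in ends_of 1 f & q.2 != q.1]].
pose R f := if #|ends_of i.+2 f| <= k + 3 then setX (ends_of i.+2 f) [set: V] else set0.
have low f : f \in A -> a * (b - 1) <= #|S f|.
  rewrite inE => /and4P[_ ha hb _].
  have -> : #|S f| = \sum_(l in ends_of i.+1 f) #|ends_of 1 f :\ l|.
    rewrite -sum1dep_card (eq_bigl (fun q : V * V => (q.1 \in ends_of i.+1 f) && (q.2 \in ends_of 1 f :\ q.1))).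
      rewrite -(pair_big_dep (mem (ends_of i.+1 f)) (fun l => mem (ends_of 1 f :\ l)) (fun _ _ => 1)) /=.
      by apply: eq_bigr => y _; rewrite sum1_card.
    by move=> q; rewrite in_setD1; case: (_ \in ends_of 1 f); rewrite ?andbT ?andbF.
  apply: leq_trans (leq_mul ha (leqnn _)) _; rewrite -sum_nat_const.
  apply: leq_sum => l _; apply: leq_trans (leq_sub2r 1 hb) _.
  rewrite leq_subLR (cardsD1 l (ends_of 1 f)) leq_add2r.
  exact: leq_b1.
have up : \sum_(f in parents) #|R f| <= #|parents| * (n * (k + 3)).
  rewrite -sum_nat_const; apply: leq_sum => f _; rewrite /R.
  case: ifP => [le|_]; last by rewrite cards0.
  by rewrite cardsX cardsT card_ord mulnC leq_mul2l le orbT.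
rewrite -sum_nat_const; apply: leq_trans (leq_trans _ up).
  by apply: leq_sum low.
apply: (@switching _ _ _ A parents S R (fun f q => upd f q.2 q.1)
  (fun f q => (q.2, f q.2)) (fun g w => (upd g w.1 w.2, (g w.1, w.1)))) => f [l y].
rewrite inE => /andP[pf /and3P[_ _ hk]]; rewrite inE /= => /and3P[lp yp yl].
rewrite upd_upd updE; split=> //.
  rewrite inE in pf; rewrite inE; have [fr _] := parentP _ _ pf.
  have nf w : f w <> y by apply/leafP.
  apply: upd_parent => //; first by apply/eqP=> yr; apply: (nf r); rewrite fr yr.
  by case=> [|j]; [rewrite eq_sym | apply/eqP/nf].
have le : #|ends_of i.+2 (upd f y l)| <= k + 3.
  by apply: leq_trans (card_pendant_upd _ _ _ _) _; rewrite leq_add2r.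
rewrite /R le !inE andbT /=; rewrite !inE in lp yp pf; exact: pendant_upd.
Qed.

End Switch.

(** * Almost all trees have many pendant paths and small degrees *)

(** The constant [g] may depend on the fraction [1/m] of trees that is given up;
with this order of quantifiers, bounds on the average number of switchings
suffice. *)
Definition linear_ends i := forall m, exists g N, 0 < g /\
  forall n (r : 'I_n), N <= n ->
    m * #|[set f in parents r | #|ends_of i f| * g < n]| <= #|parents r|.

Lemma leaves_arith B P n k g m : g = 16 * m.+1 -> g <= n -> k * g <= n ->
  B * ((n - k.*2 - 1) * (n - k.*2 - 2)) <= (P * n * k.+1).*2 -> m * B <= P.
Proof.
move=> Eg gn kg h; set a := n - k.*2 - 1 in h; set b := n - k.*2 - 2 in h.
have k16 : k * 16 <= n.
  by apply: leq_trans kg; rewrite leq_mul2l Eg leq_pmulr ?orbT.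
have n16 : 16 <= n by apply: leq_trans gn; rewrite Eg leq_pmulr.
have ha : n <= 2 * a by rewrite /a; move: k16 n16; clear; lia.
have hb : n <= 2 * b by rewrite /b; move: k16 n16; clear; lia.
have hk : k.+1 * g <= 2 * n by rewrite mulSn; move: kg gn; clear; lia.
have n0 : 0 < n * n by rewrite muln_gt0; move: n16; case: (n).
suff : B * m.+1 <= P by move: P B {h} => P B; clear; nia.
rewrite -(leq_pmul2l (isT : 0 < 16)) -(leq_pmul2l n0).
apply: (@leq_trans (4 * g * (B * (a * b)))).
  have := leq_mul ha hb; rewrite Eg => hab.
  apply: (@leq_trans ((2 * a * (2 * b)) * (16 * (B * m.+1)))); first by rewrite leq_mul2r hab orbT.
  apply: eq_leq; ring.
apply: leq_trans (leq_mul (leqnn _) h) _.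
have -> : 4 * g * (P * n * k.+1).*2 = 8 * P * n * (k.+1 * g) by rewrite -muln2; ring.
apply: leq_trans (leq_mul (leqnn _) hk) _; apply: eq_leq; ring.
Qed.

Lemma linear_leaves : linear_ends 1.
Proof.
move=> m; exists (16 * m.+1), (16 * m.+1); split=> // n r Nn.
apply: (leaves_arith (erefl _) Nn (leq_divM n (16 * m.+1))).
apply: leq_trans (card_few_leaves r (n %/ (16 * m.+1))).
rewrite leq_mul2r; apply/orP; right; apply/subset_leq_card/subsetP=> f.
rewrite !inE => /andP[-> h]; rewrite leq_divRL //; exact: ltnW.
Qed.

Lemma pendant_arith B P n a b k g g1 g2 m : 0 < n -> 0 < g1 -> 0 < g2 ->
  g = 24 * (g1 * g2) * m -> n <= 2 * a * g1 -> n <= 3 * (b - 1) * g2 ->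
  (k + 3) * g <= 4 * n -> B * (a * (b - 1)) <= P * (n * (k + 3)) -> m * B <= P.
Proof.
move=> n0 g10 g20 Eg ha hb hk h; set c := b - 1 in hb h.
have pos : 0 < n * n * (24 * (g1 * g2)) by rewrite !muln_gt0 n0 g10 g20.
rewrite -(leq_pmul2l pos).
apply: (@leq_trans (6 * g1 * g2 * g * (B * (a * c)))).
  apply: (@leq_trans ((2 * a * g1) * (3 * c * g2) * (24 * (g1 * g2)) * (m * B))).
    exact: leq_mul (leq_mul (leq_mul ha hb) (leqnn _)) (leqnn _).
  by apply: eq_leq; rewrite Eg; ring.
apply: leq_trans (leq_mul (leqnn _) h) _.
have -> : 6 * g1 * g2 * g * (P * (n * (k + 3))) = 6 * g1 * g2 * P * n * ((k + 3) * g) by ring.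
apply: leq_trans (leq_mul (leqnn _) hk) _; apply: eq_leq; ring.
Qed.

(** Give up a third of the fraction each for the trees with few shorter paths, with
few leaves, and with enough of both but few longer paths. *)
Lemma linear_endsS i : linear_ends i.+1 -> linear_ends i.+2.
Proof.
move=> lin m; have [g1 [N1 [g10 H1]]] := lin (3 * m.+1).
have [g2 [N2 [g20 H2]]] := linear_leaves (3 * m.+1).
pose g := 24 * (g1 * g2) * (3 * m.+1).
have g0 : 0 < g by rewrite !muln_gt0 g10 g20.
exists g, (N1 + N2 + g + g1 + 2 * g2); split=> // n r Nn.
have {H1} h1 := H1 n r _; have {}h1 := h1 (leq_trans _ Nn).
have {H2} h2 := H2 n r _; have {}h2 := h2 (leq_trans _ Nn).
have {}h1 := h1 ltac:(clear; lia); have {}h2 := h2 ltac:(clear; lia).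
have gn : g <= n by move: Nn; clear; lia.
have g1n : g1 <= n by move: Nn; clear; lia.
have g2n : 2 * g2 <= n by move: Nn; clear; lia.
have n0 : 0 < n by apply: leq_trans gn.
set a := n %/ g1; set b := n %/ g2; set k := n %/ g.
have a0 : 0 < a by rewrite divn_gt0.
have b0 : 2 <= b by rewrite leq_divRL.
have h3 := card_few_pendant r i a b k.
set B3 := [set f in parents r | _] in h3.
have h4 : 3 * m.+1 * #|B3| <= #|parents r|.
  apply: (pendant_arith n0 g10 g20 (erefl g) _ _ _ h3).
  - have := ltn_ceil n g10; rewrite -/a mulSn => h.
    by move: a0 h g10; rewrite -mulnA; move: (a) => a'; clear; nia.
  - have := ltn_ceil n g20; rewrite -/b mulSn => h.
    by move: b0 h; rewrite -mulnA; move: (b) => b'; clear; nia.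
  - rewrite mulnDl; have := leq_divM n g; rewrite -/k; move: gn; clear; lia.
set B := [set f in parents r | _].
have : #|B| <= #|[set f in parents r | #|ends_of i.+1 f| * g1 < n]| +
    (#|[set f in parents r | #|ends_of 1 f| * g2 < n]| + #|B3|).
  apply: leq_trans (leq_trans (leq_card_setU _ _) (leq_add (leqnn _) (leq_card_setU _ _))).
  apply/subset_leq_card/subsetP=> f; rewrite !inE => /andP[-> h] /=.
  case: (ltnP (#|ends_of i.+1 f| * g1) n) => //= ha.
  case: (ltnP (#|ends_of 1 f| * g2) n) => //= hb.
  rewrite /k leq_divRL // (ltnW h) andbT; apply/andP; split.
    by rewrite -(leq_pmul2r g10); apply: leq_trans ha; apply: leq_divM.
  by rewrite -(leq_pmul2r g20); apply: leq_trans hb; apply: leq_divM.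
move: h1 h2 h4; move: #|[set f in parents r | #|ends_of i.+1 f| * g1 < n]| => x1.
move: #|[set f in parents r | #|ends_of 1 f| * g2 < n]| => x2.
move: #|B3| #|B| #|parents r| => x3 x p; clear; nia.
Qed.

Lemma linear_pendant i : linear_ends i.+1.
Proof. by elim: i => [|i IH]; [apply: linear_leaves | apply: linear_endsS]. Qed.

Lemma small_degrees e m : 0 < e -> exists N, forall n (r : 'I_n), N <= n ->
  m * #|[set f in parents r | [exists p, n %/ e < #|fiber f p|]]| <= #|parents r|.
Proof.
move=> e0; exists (e + 4 * (e * e) * m) => n r Nn.
have := card_bad_degree r (n %/ e); set D := n %/ e.
move: #|[set f in parents r | _]| #|parents r| => B P h.
have en : e <= n by move: Nn; clear; lia.
have n0 : 0 < n by apply: leq_trans en.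
have D0 : 0 < D by rewrite divn_gt0.
have hD : n <= 2 * D * e.
  have := ltn_ceil n e0; rewrite -/D mulSn => h'.
  by move: D0 h' e0; rewrite -mulnA; move: (D) => a'; clear; nia.
rewrite -(leq_pmul2l n0) -(leq_pmul2l n0).
apply: (@leq_trans ((2 * D * e) * (2 * D * e) * (m * B))).
  by rewrite mulnA leq_mul // leq_mul.
have -> : 2 * D * e * (2 * D * e) * (m * B) = 4 * (e * e) * m * (B * (D * D)) by ring.
apply: leq_trans (leq_mul (leqnn _) h) _.
have -> : 4 * (e * e) * m * (P * n) = n * ((4 * (e * e) * m) * P) by ring.
rewrite leq_mul2l; apply/orP; right; rewrite leq_mul2r; apply/orP; right.
by move: Nn; clear; lia.
Qed.

(** * Almost every tree can be built without wasting a move *)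

Lemma start_inv n (r : 'I_n) (f : 'I_n -> 'I_n) th N0 : f r = r ->
  N0 <= #|[set l | pendant f 12 l]| ->
  core_inv r f th N0 [set r] 1%g set0 set0 (n - 1).
Proof.
move=> fr le; have n0 : 0 < n by case: (n) r {f fr le th N0} => [[]|].
have no a b : adj (set0 : {set edge n}) a b = false.
  by case E: (adj _ a b) => //; have [e] := adjP _ _ _ E; rewrite inE.
split.
- by split; [rewrite inE | move=> x; rewrite !inE => /eqP->; rewrite fr].
- by rewrite cards1 addnC subnK.
- by rewrite cards0 leq_subr.
- by split=> [a b|x]; [rewrite no | rewrite inE => /eqP->; rewrite eqxx].
split=> [v _|].
  suff -> : deg set0 v = 0 by [].
  by apply/eqP; rewrite cards_eq0; apply/eqP/setP=> b; rewrite !inE no.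
apply: leq_trans (leq_addr _ _); apply: leq_trans le _.
apply/subset_leq_card/subsetP=> l; rewrite !inE => p; rewrite p /=.
exact: (@pendant_root _ f 12 l 10 r fr p isT).
Qed.

Lemma constants_arith n g x D N0 c : 0 < g -> N0 = n %/ g -> 48 * 96 * g <= N0 -> c = N0 %/ 6 ->
  D * (48 * 48 * g * g) <= n -> N0 <= x ->
  [/\ 0 < c, n.*2 * (3 + D) <= c * c & c * 11 + (c + c + 3) * 24 + 100 <= x * 11].
Proof.
move=> g0 EN hN Ec hD hx; have gN : 48 * 96 <= N0.
  by apply: leq_trans hN; rewrite leq_pmulr.
have c6 : c * 6 <= N0 by rewrite Ec; apply: leq_divM.
have c12 : N0 <= 12 * c.
  by have := ltn_ceil N0 (isT : 0 < 6); rewrite -Ec; move: gN; clear; lia.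
have nN : n <= 2 * (N0 * g).
  have := ltn_ceil n g0; rewrite -EN mulSn => h.
  by apply: leq_trans (ltnW h) _; rewrite mul2n -addnn leq_add2r leq_pmull //;
    apply: leq_trans gN.
split; first by move: c12 gN; clear; lia.
  have h1 : 288 * (2 * n * D) <= N0 * N0.
    have p : 0 < 8 * (g * g) by rewrite !muln_gt0 g0.
    rewrite -(leq_pmul2l p); apply: (@leq_trans (2 * n * (D * (48 * 48 * g * g)))).
      by apply: eq_leq; ring.
    apply: leq_trans (leq_mul (leqnn _) hD) _; apply: (@leq_trans (2 * (n * n))).
      by rewrite mulnA.
    apply: leq_trans (leq_mul (leqnn _) (leq_mul nN nN)) _; apply: eq_leq; ring.
  have h2 : 288 * (6 * n) <= N0 * N0.
    apply: (@leq_trans (N0 * (36 * 96 * g))).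
      apply: leq_trans (leq_mul (leqnn _) (leq_mul (leqnn _) nN)) _.
      by apply: eq_leq; ring.
    rewrite leq_mul2l; apply/orP; right; apply: leq_trans hN.
    by rewrite -!mulnA leq_mul2r orbT.
  have h3 := leq_mul c12 c12.
  rewrite -(leq_pmul2l (isT : 0 < 288)); move: h1 h2 h3; rewrite -muln2.
  by move: (N0 * N0) => q; clear; nia.
by move: c6 gN hx; clear; lia.
Qed.

(** With [N0 = n/g] pendant paths, a sixth of [N0] is taken for the danger threshold
and another sixth for the waste.  The waste is of order [g] times the maximum
degree and has to stay below a sixth of [n/g], so degrees up to [n/e] with [e] of
order [g * g] are harmless. *)
Lemma tree_win g : 0 < g -> exists e N, 0 < e /\
  forall n (r : 'I_n) (f : {ffun 'I_n -> 'I_n}), N <= n -> f \in parents r ->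
    n <= #|ends_of 12 f| * g -> (forall p, #|fiber f p| <= n %/ e) ->
    maker_wins_in (copies (tree_of r f)) (n - 1).
Proof.
move=> g0; pose e := 48 * 48 * g * g.
exists e, (48 * 96 * g * g); split; first by rewrite !muln_gt0 g0.
move=> n r f Nn; rewrite inE => pf ge deg; have [fr c] := parentP _ _ pf.
set N0 := n %/ g; set w := N0 %/ 6.
have N0g : N0 <= #|ends_of 12 f|.
  by rewrite -(leq_pmul2r g0); apply: leq_trans ge; apply: leq_divM.
have [||w0 h1 h2] := @constants_arith n g N0 (n %/ e) N0 w g0 (erefl _) _ (erefl _) _ (leqnn _).
- by rewrite leq_divRL.
- exact: leq_divM.
apply: (@mwin_maker_wins _ _ (embedded r f)) => [M|]; first exact: embedded_copy.
exact: (core_win c deg w0 h1 h2 (start_inv w fr N0g)).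
Qed.

Lemma almost_all_trees m : exists N, forall n, N <= n ->
  0 < #|labeled_trees n| /\
  m * #|[set T in labeled_trees n | ~~ `[< maker_wins_in (copies T) (n - 1) >]]| <= #|labeled_trees n|.
Proof.
have [g [N1 [g0 H1]]] := linear_pendant 11 (2 * m).
have [e [N2 [e0 H2]]] := tree_win g0.
have [N3 H3] := small_degrees (2 * m) e0.
exists (N1 + N2 + N3).+1; case=> // n Nn; pose r : 'I_n.+1 := ord0.
have := H1 n.+1 r; have := H2 n.+1 r; have := H3 n.+1 r.
move=> {H1 H2 H3} H3 H2 H1.
have {}H1 := H1 ltac:(move: Nn; clear; lia).
have {}H3 := H3 ltac:(move: Nn; clear; lia).
have {}H2 f := H2 f ltac:(move: Nn; clear; lia).
have EF : labeled_trees n.+1 = tree_of r @: parents r.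
  rewrite (labeled_treesE r); apply/setP=> T.
  by apply/imsetP/imsetP=> -[f h ->]; exists f; rewrite // inE in h *.
have cF : #|labeled_trees n.+1| = #|parents r|.
  rewrite EF card_in_imset // => f h; rewrite !inE; exact: tree_of_inj.
split.
  rewrite cF; apply/card_gt0P; exists [ffun=> r]; rewrite inE; apply/parentP.
  by split=> [|x]; [rewrite ffunE | exists 1; rewrite /= ffunE].
rewrite cF; set B1 := [set f in parents r | _] in H1; set B3 := [set f in parents r | _] in H3.
have : #|[set T in labeled_trees n.+1 | ~~ `[< maker_wins_in (copies T) (n.+1 - 1) >]]|
    <= #|B1| + #|B3|.
  apply: leq_trans (leq_card_setU _ _); apply: leq_trans (leq_imset_card (tree_of r) _).
  apply/subset_leq_card/subsetP=> T; rewrite inE EF => /andP[/imsetP[f pf ->] /asboolP nw].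
  apply: imset_f; rewrite !inE in pf *; rewrite pf /=; apply/negPn/negP; rewrite negb_or -leqNgt.
  case/andP=> h1; rewrite negb_exists => /forallP h3; apply: nw; apply: H2 => //.
    by rewrite inE.
  by move=> p; rewrite leqNgt.
by move: H1 H3; move: #|B1| #|B3| #|_| #|_| => x y z t; clear; nia.
Qed.

Lemma card_set_split (T : finType) (A : {set T}) (P : pred T) :
  #|A| = #|[set x in A | P x]| + #|[set x in A | ~~ P x]|.
Proof.
rewrite -(cardsID [set x | P x] A); congr addn; apply: eq_card => x.
  by rewrite !inE.
by rewrite !inE andbC.
Qed.

Local Open Scope classical_set_scope.
Local Open Scope ring_scope.

Theorem theorem1p4 (R : realType) :
  (fun n : nat =>
     uniform_pr R (labeled_trees n)
       (fun T => maker_wins_in (copies T) (n - 1)%N))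
    @ \oo --> (1 : R).
Proof.
apply/cvgrPdist_le => /= e e0.
pose m := Num.bound e^-1.
have [N H] := almost_all_trees m.
exists N => // n /= Nn; have [pos le] := H n Nn.
rewrite /uniform_pr; set A := finset _; set b := #|labeled_trees n| in pos le *.
set B := finset _ in le.
have AB : b = (#|A| + #|B|)%N by exact: card_set_split.
have b0 : (0 < b%:R :> R) by rewrite ltr0n.
have -> : 1 - #|A|%:R / b%:R = #|B|%:R / b%:R :> R.
  apply: (mulIf (lt0r_neq0 b0)); rewrite mulrBl !divfK ?lt0r_neq0 // mul1r AB natrD.
  by rewrite addrC addKr.
rewrite ger0_norm ?divr_ge0 ?ler0n // ler_pdivrMr //.
have m0 : e^-1 < m%:R by apply: archi_boundP; rewrite invr_ge0 ltW.
have : (m%:R * #|B|%:R <= b%:R :> R) by rewrite -natrM ler_nat.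
rewrite -(ler_pM2l e0); apply: le_trans; rewrite mulrA ler_peMl ?ler0n //.
by rewrite -ler_pdivrMl // mulr1 ltW.
Qed.
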